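(* Let $\mathcal{S}\subset L^\Phi(\Omega,\mathcal{F},\mathbb{P})$ be a nonempty convex set of probability densities that is closed in $L^1$, and suppose that the functional $\rho(\eta)=\sup_{h\in\mathcal{S}}\mathbb{E}[\eta h]$ on $L^\Psi$ is rearrangement invariant. Let $\xi\in M^\Psi$ have distribution $\mu$, and let $\xi_n\colon(\Omega,\mathcal{F},\mathbb{P})\to\mathbb{R}$, $n\ge 1$, be an i.i.d. sequence of random variables with the same distribution $\mu$ as $\xi$. For each $N\ge 1$ define the (random) sample distribution $$\mu_N=\frac1N\sum_{n=1}^N\delta_{\xi_n},$$ where $\delta_y$ denotes the Dirac measure concentrated at $y$. Then almost surely $\rho(\mu_N)\to\rho(\mu)$ as $N\to\infty$.
   Context: $(\Omega,\mathcal{F},\mathbb{P})$ is an atomless probability space. A probability density is an $h\in L^1$ with $h\ge 0$ a.s. and $\mathbb{E}[h]=1$. Young functions: $\Phi$ is an even real-valued function on $\mathbb{R}$ with $\Phi(x)=\int_0^{|x|}\phi(u)\,du$, where $\phi\colon\mathbb{R}_+\to\mathbb{R}_+$ is nondecreasing, continuous at $0$, $\phi(x)=0$ if and only if $x=0$, and $\lim_{x\to+\infty}\phi(x)=+\infty$. The conjugate Young function is $\Psi(x)=\int_0^{|x|}\psi(u)\,du$, where $\psi(x)=\inf\{u\mid\phi(u)>x\}$ for $x\ge 0$. Orlicz spaces: for $\Theta\in\{\Phi,\Psi\}$, $L^\Theta=\{\xi\mid \text{there is } k>0 \text{ with } \mathbb{E}[\Theta(k\xi)]<\infty\}$ and $M^\Theta=\{\xi\mid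 \text{for all } k>0,\ \mathbb{E}[\Theta(k\xi)]<\infty\}$. When $\mathcal{S}\subset L^\Phi$ is a convex $L^1$-closed set of probability densities, the functional $\rho(\eta)=\sup_{h\in\mathcal{S}}\mathbb{E}[\eta h]$ is finite for every $\eta\in L^\Psi$. The functional $\rho$ is rearrangement invariant if $\rho(\eta)=\rho(\eta')$ whenever $\eta,\eta'$ have the same distribution. For a rearrangement invariant $\rho$ and a probability measure $\mu$ on $\mathbb{R}$ that is the distribution of an element $\eta\in L^\Psi$, write $\rho(\mu)=\rho(\eta)$. *)

(* Defs.v *)
From HB Require Import structures.
From mathcomp Require Import all_boot all_order all_algebra finmap.
From mathcomp Require Import all_classical all_reals all_analysis.
From mathcomp Require Import giry.

Set Implicit Arguments.
Unset Strict Implicit.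
Unset Printing Implicit Defensive.

Import Order.TTheory GRing.Theory Num.Theory.
Import numFieldNormedType.Exports.

Local Open Scope classical_set_scope.
Local Open Scope ring_scope.

Section Young.
Context {R : realType}.
Implicit Types phi : R -> R.

(* A function R_+ -> R_+ is represented by a total function R -> R of which
   only the values on [0, +oo[ matter; continuity at 0 is thus one-sided. *)
Record young_integrand phi : Prop := YoungIntegrand {
  young_ge0 : forall x, 0 <= x -> 0 <= phi x;
  young_nondecreasing : forall x y, 0 <= x -> x <= y -> phi x <= phi y;
  young_cvg0 : phi x @[x --> 0^'+] --> phi 0;
  young_eq0 : forall x, 0 <= x -> (phi x = 0 <-> x = 0);
  young_cvgy : phi x @[x --> +oo] --> +oo }.

Definition young phi (x : R) : R :=
  \int[@lebesgue_measure R]_(u in `[0, `|x|]) phi u.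

Definition conjugate_integrand phi (x : R) : R :=
  inf [set u | 0 <= u /\ x < phi u].

Definition conjugate_young phi : R -> R := young (conjugate_integrand phi).

End Young.

Section Probability.
Context {d : measure_display} {Omega : measurableType d} {R : realType}.
Variable P : probability Omega R.

Definition atomless : Prop :=
  forall A, measurable A -> (0 < P A)%E ->
    exists B, [/\ measurable B, B `<=` A, (0 < P B)%E & (P B < P A)%E].

Definition independent_seq (X : nat -> {RV P >-> R}) : Prop :=
  forall (I : {fset nat}) (B : nat -> set R),
    (forall n, measurable (B n)) ->
    P (\bigcap_(n in [set` I]) (X n @^-1` B n)) =
      (\prod_(n <- I) P (X n @^-1` B n))%E.

(* [distribution P X] is the raw pushforward, hence also assigns values to
   nonmeasurable sets; [measure_eq] only compares measurable ones. *)
Definition has_law (X : {RV P >-> R}) (mu : {measure set R -> \bar R}) : Prop :=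
  measure_eq (distribution P X) mu.

Definition orlicz_space (Theta : R -> R) : set {RV P >-> R} :=
  [set X : {RV P >-> R} |
    exists2 k : R, 0 < k & ('E_P[fun w => Theta (k * X w)%R] < +oo)%E].

Definition orlicz_heart (Theta : R -> R) : set {RV P >-> R} :=
  [set X : {RV P >-> R} |
    forall k : R, 0 < k -> ('E_P[fun w => Theta (k * X w)%R] < +oo)%E].

Definition probability_density : set {RV P >-> R} :=
  [set h : {RV P >-> R} | [/\ (h : Omega -> R) \in Lfun P 1,
    {ae P, forall w, 0 <= h w} & ('E_P[h] = 1)%E]].

(* Elements are random variables and not classes modulo a.s. equality, but a
   closed set in this sense contains every a.s. modification of its members
   (take a constant sequence), so it is a union of such classes. *)
Definition L1_closed (S : set {RV P >-> R}) : Prop :=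
  forall (h_ : nat -> {RV P >-> R}) (h : {RV P >-> R}),
    (forall n, S (h_ n)) -> (h : Omega -> R) \in Lfun P 1 ->
    ('N[P]_1[EFin \o (h_ n \- h)%R] @[n --> \oo] --> 0)%E -> S h.

Definition rho (S : set {RV P >-> R}) (eta : {RV P >-> R}) : \bar R :=
  ereal_sup [set 'E_P[(eta \* h)%R] | h in S]%E.

Definition rearrangement_invariant (V : set {RV P >-> R})
    (r : {RV P >-> R} -> \bar R) : Prop :=
  forall eta eta' : {RV P >-> R}, V eta -> V eta' ->
    measure_eq (distribution P eta) (distribution P eta') -> r eta = r eta'.

(* The value at [mu] of [r], seen as a function of the law: [r eta] for a
   chosen [eta] in [V] with law [mu] (junk if there is none).  By [on_lawE] the
   choice is irrelevant when [r] is rearrangement invariant. *)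
Definition on_law (V : set {RV P >-> R}) (r : {RV P >-> R} -> \bar R)
    (mu : {measure set R -> \bar R}) : \bar R :=
  r (xget (cst 0 : {mfun Omega >-> R}) [set eta | V eta /\ has_law eta mu]).

Lemma on_lawE V r mu (eta : {RV P >-> R}) : rearrangement_invariant V r ->
  V eta -> has_law eta mu -> on_law V r mu = r eta.
Proof.
move=> ri Veta etamu; rewrite /on_law.
have [|Vx xmu] := @xgetPex _ (cst 0 : {mfun Omega >-> R})
  [set eta | V eta /\ has_law eta mu]; first by exists eta.
by apply: ri => // A mA; rewrite xmu// etamu.
Qed.

(* Sequences are indexed from 0, so the first N sample points are
   [X 0 w, ..., X N.-1 w]. *)
Definition empirical (X : nat -> {RV P >-> R}) (N : nat) (w : Omega) :
    {measure set R -> \bar R} :=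
  mscale (N%:R^-1)%:nng (msum (fun n => dirac (X n w)) N).

End Probability.

Arguments orlicz_space {d Omega R} P Theta.
Arguments orlicz_heart {d Omega R} P Theta.
Arguments probability_density {d Omega R} P.

(* Main.v *)
Require Import Defs.
From HB Require Import structures.
From mathcomp Require Import all_boot all_order all_algebra finmap.
From mathcomp Require Import all_classical all_reals all_analysis.
From mathcomp Require Import giry.
From mathcomp Require Import measurable_realfun ring lra.
Set Implicit Arguments.
Unset Strict Implicit.
Unset Printing Implicit Defensive.
Import Order.TTheory GRing.Theory Num.Theory.
Import numFieldNormedType.Exports.
Local Open Scope classical_set_scope.
Local Open Scope ring_scope.

(** The functional [rho S] is continuous for convergence in the Orlicz space
    [LPsi], and the empirical measures can be realised by random variables which
    converge to [xi] in this sense.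

    Continuity rests on a uniform bound ([densities_bounded]): there is a
    constant [K] such that the expectation of [Y * |h|] is at most [K] for all
    [h] in [S] and all [Y >= 0] for which [Psi Y] has expectation at most [1].
    Young's inequality gives such a constant for each [h] ([orlicz_pairing]).
    If it could not be chosen independently of [h], then a series of members of
    [S] with dyadic weights, which belongs to [S] since [S] is convex and closed
    in L1 ([density_series]), would contradict the bound for its own sum.

    For the realisation, the line is divided into finitely many cells, small
    ones in a bounded region and two unbounded ones.  As the probability space
    is atomless, an event can be split into events of any prescribed
    probabilities ([atomless_partition], from Sierpinski's theorem), so that some
    [eta] with the empirical law lies in the same cell as [xi] outside an event
    of probability at most the sum of the positive parts of the differences
    between empirical frequencies and probabilities of the cells
    ([empirical_coupling]).  The difference of [xi] and [eta] is then controlled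
    by the size of the cells, by this exceptional event, and by the tails of [xi]
    and [eta]; the uniform bound turns this into an estimate for [rho S]
    ([coupling_pairing]).

    It remains to know that the empirical frequencies do not exceed the
    probabilities of the cells by much, and that the empirical tails, measured
    with [Psi], are not much larger than those of [xi], which are small because
    [xi] lies in the Orlicz heart.  Both are upper bounds for sample means of
    nonnegative integrable functions, and follow from a one-sided strong law of
    large numbers ([slln_upper]): truncation, Chebyshev's inequality and the
    Borel-Cantelli lemma along the sample sizes [r * 2 ^ j], and interpolation
    by monotonicity.  Rearrangement invariance is used only to replace the value
    of [rho S] at a law by its value at the realisations. *)

(** * Young functions *)

Section young_of_nondecreasing.
Context {R : realType} (g : R -> R).
Hypothesis g_ge0 : forall x : R, 0 <= x -> 0 <= g x.
Hypothesis g_nd : forall x y : R, 0 <= x -> x <= y -> g x <= g y.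
Local Notation mu := (@lebesgue_measure R).

Lemma integrable_nondecreasing_itv (x y : R) (b1 b2 : bool) : 0 <= x ->
  mu.-integrable [set` Interval (BSide b1 x) (BSide b2 y)] (EFin \o g).
Proof.
move=> x0; set D := [set` _].
have DE z : D z -> 0 <= z <= y.
  rewrite /D /= itv_boundlr/= => /andP[zx zy]; apply/andP; split.
    by apply: (le_trans x0); move: zx; case: b1 {D} => //=; rewrite bnd_simp// => /ltW.
  by move: zy; case: b2 {D} => //=; rewrite bnd_simp// => /ltW.
apply: measurable_bounded_integrable => //.
- exact: measurable_itv.
- rewrite /D /= lebesgue_measure_itv/=; case: ifP => // _.
  by rewrite -EFinB ltry.
(* [g] is monotone on the nonnegative half-line only; clamping the argument
   makes it monotone on the whole line without changing it on [D] *)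
- apply: (@eq_measurable_fun _ _ _ _ D (fun z => g (Num.max 0 z))).
    by move=> z /[!inE] /DE /andP[z0 _]; rewrite max_r.
  apply: nondecreasing_measurable; first exact: measurable_itv.
  move=> s t st; apply: g_nd; first by rewrite le_max lexx.
  by rewrite ge_max !le_max lexx st/= orbT.
- exists (g y); split; first exact: num_real.
  move=> M gM z /= /DE /andP[z0 zy]; rewrite ger0_norm ?g_ge0//.
  by rewrite (le_trans (g_nd z0 zy))// ltW.
Qed.

Lemma young_increment (x y : R) : 0 <= x -> x <= y ->
  (y - x) * g x <= young g y - young g x.
Proof.
move=> x0 xy; rewrite /young !ger0_norm ?(le_trans x0 xy)//.
rewrite Rintegral_itvB ?bnd_simp//; last exact: integrable_nondecreasing_itv.
have muxy : fine (mu `]x, y]) = y - x.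
  by rewrite lebesgue_measure_itv/= lte_fin; case: ltgtP xy => //= -> _; rewrite subrr.
have mxy : measurable (`]x, y]%classic : set R) by exact: measurable_itv.
rewrite mulrC -muxy -(Rintegral_cst mu mxy (g x)); apply: le_Rintegral => //=.
- apply: measurable_bounded_integrable => //.
    by rewrite /= lebesgue_measure_itv/=; case: ifP => // _; rewrite -EFinB ltry.
  by exists `|g x|; split; [exact: num_real|move=> M rM z _/=; exact: ltW].
- exact: integrable_nondecreasing_itv.
- by move=> z; rewrite in_itv/= => /andP[/ltW xz _]; exact: g_nd.
Qed.

Lemma young0 : young g 0 = 0.
Proof. by rewrite /young normr0 set_itv1 Rintegral_set1. Qed.

Lemma young_norm x : young g `|x| = young g x.
Proof. by rewrite /young normr_id. Qed.

Lemma le_young x y : `|x| <= `|y| -> young g x <= young g y.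
Proof.
move=> xy; rewrite -young_norm -[leRHS]young_norm -subr_ge0.
have := young_increment (normr_ge0 x) xy.
by apply: le_trans; rewrite mulr_ge0 ?subr_ge0// g_ge0.
Qed.

Lemma young_nonneg x : 0 <= young g x.
Proof. by rewrite -young0 le_young// normr0. Qed.

Lemma mul_le_young x : 0 <= x -> x * g x <= young g (2 * x).
Proof.
move=> x0; have := @young_increment x (2 * x) x0 ltac:(lra).
by have := young_nonneg x; rewrite (_ : 2 * x - x = x); lra.
Qed.

Lemma measurable_young D : measurable D -> measurable_fun D (young g).
Proof.
move=> mD; apply: (@eq_measurable_fun _ _ _ _ D ((fun z => young g (Num.max 0 z)) \o Num.norm)).
  by move=> z _ /=; rewrite max_r// young_norm.
apply: measurableT_comp; last exact: normr_measurable.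
apply: nondecreasing_measurable => // s t st; apply: le_young.
have max0 (u : R) : 0 <= Num.max 0 u by rewrite le_max lexx.
by rewrite !ger0_norm// ge_max max0 le_max st orbT.
Qed.

End young_of_nondecreasing.

Section conjugate.
Context {R : realType} (phi : R -> R).
Hypothesis hphi : young_integrand phi.
Local Notation psi := (conjugate_integrand phi).

Let psiset_neq0 x : exists2 u, 0 <= u & x < phi u.
Proof.
have /cvgryPgt/(_ x)[M [_ hM]] := young_cvgy hphi.
exists (Num.max 0 (M + 1)); first by rewrite le_max lexx.
by apply: hM; rewrite lt_max ltrDl ltr01 orbT.
Qed.

Let has_inf_psiset x : has_inf [set u | 0 <= u /\ x < phi u].
Proof.
split; first by have [u u0 xu] := psiset_neq0 x; exists u.
by exists 0 => u [].
Qed.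

Lemma conjugate_integrand_ge0 x : 0 <= psi x.
Proof. by apply: lb_le_inf => [|u []//]; have [] := has_inf_psiset x. Qed.

Lemma conjugate_integrand_nd x y : x <= y -> psi x <= psi y.
Proof.
move=> xy; apply: lb_le_inf => [|u [u0 yu]]; first by have [] := has_inf_psiset y.
apply: ge_inf; first by have [] := has_inf_psiset x.
by split => //; exact: le_lt_trans yu.
Qed.

Let psi_ge0 z : 0 <= z -> 0 <= psi z.
Proof. by move=> _; exact: conjugate_integrand_ge0. Qed.

Let psi_nd z t : 0 <= z -> z <= t -> psi z <= psi t.
Proof. by move=> _; exact: conjugate_integrand_nd. Qed.

Lemma conjugate_young_ge0 x : 0 <= conjugate_young phi x.
Proof. exact: young_nonneg psi_ge0 psi_nd x. Qed.

Lemma le_conjugate_young x y : `|x| <= `|y| ->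
  conjugate_young phi x <= conjugate_young phi y.
Proof. exact: le_young psi_ge0 psi_nd x y. Qed.

Lemma measurable_conjugate_young D : measurable D ->
  measurable_fun D (conjugate_young phi).
Proof. exact: measurable_young psi_ge0 psi_nd D. Qed.

(** Young's inequality up to a factor [2] in the arguments, which is harmless
    in Orlicz spaces and makes the proof immediate: if [y <= phi x], then
    [x * y <= x * phi x <= young phi (2 * x)]; if [phi x < y], then [x <= psi y]
    and the roles are exchanged. *)
Lemma young_inequality x y : 0 <= x -> 0 <= y ->
  x * y <= young phi (2 * x) + conjugate_young phi (2 * y).
Proof.
have Phi0 := young_nonneg (young_ge0 hphi) (young_nondecreasing hphi).
move=> x0 y0; have [yx|xy] := leP y (phi x).
  rewrite -[leLHS]addr0 lerD//; last exact: conjugate_young_ge0.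
  apply: le_trans (mul_le_young (young_ge0 hphi) (young_nondecreasing hphi) x0).
  exact: ler_wpM2l.
rewrite -[leLHS]add0r; apply: lerD; first exact: Phi0.
apply: le_trans (mul_le_young psi_ge0 psi_nd y0); rewrite mulrC ler_wpM2l//.
apply: lb_le_inf => [|u [u0 yu]]; first by have [] := has_inf_psiset y.
rewrite leNgt; apply/negP => /ltW ux.
have := young_nondecreasing hphi u0 ux; lra.
Qed.

End conjugate.

(** * Atomless probability spaces *)

Section atomless.
Context {d : measure_display} {Omega : measurableType d} {R : realType}.
Variable P : probability Omega R.
Hypothesis atomlessP : atomless P.

Let PE A : measurable A -> P A = (fine (P A))%:E.
Proof. by move=> mA; rewrite fineK// fin_num_measure. Qed.

(** Halving repeatedly, a nonnegligible event contains nonnegligible events of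
    arbitrarily small probability. *)
Lemma atomless_small (A : set Omega) (n : nat) : measurable A -> (0 < P A)%E ->
  exists B, [/\ measurable B, B `<=` A, (0 < P B)%E & fine (P B) <= 2^-1 ^+ n].
Proof.
move=> mA PA; elim: n => [|n [B [mB BA PB PBn]]].
  exists A; split => //; rewrite expr0 -lee_fin fineK ?fin_num_measure//.
  exact: probability_le1.
have [C [mC CB PC PCB]] := atomlessP mB PB.
have mBC : measurable (B `\` C) by exact: measurableD.
have E : fine (P B) = fine (P C) + fine (P (B `\` C)).
  rewrite -fineD ?fin_num_measure// -measureU//; last by rewrite setDIK.
  by rewrite setDUK.
have PCBr : fine (P C) < fine (P B) by rewrite fine_lt ?fin_num_measure.
have [h|h] := leP (fine (P C)) (2^-1 * fine (P B)).
  exists C; split => //; first exact: subset_trans BA.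
  by rewrite exprS (le_trans h)// ler_pM2l// invr_gt0.
exists (B `\` C); split => //; first by apply: subset_trans BA; exact: subDsetl.
  by rewrite PE// lte_fin; lra.
by rewrite exprS; lra.
Qed.

(** Sierpinski's theorem: the probabilities of the subevents of an event [A]
    fill the whole interval between [0] and [P A]. *)
Lemma atomless_subset (A : set Omega) (t : R) : measurable A ->
  0 <= t -> t <= fine (P A) ->
  exists B, [/\ measurable B, B `<=` A & fine (P B) = t].
Proof.
move=> mA t0 tA.
(* greedy construction: [ext B C] says that [C] extends [B] within [A] at
   probability at most [t], and gains at least half of what is possible *)
pose ok (B : set Omega) := [/\ measurable B, B `<=` A & fine (P B) <= t].
pose ext (B C : set Omega) := [/\ ok C, B `<=` C &
  forall D, ok D -> B `<=` D -> fine (P D) - fine (P B) <= 2 * (fine (P C) - fine (P B))].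
have [nx nxP] : {nx : set Omega -> set Omega & forall B, ok B -> ext B (nx B)}.
  apply: (@choice _ _ (fun B C => ok B -> ext B C)) => B.
  have [okB|] := pselect (ok B); last by exists B.
  pose V := [set fine (P D) - fine (P B) | D in [set D | ok D /\ B `<=` D]].
  have V0 : V 0 by exists B; rewrite ?subrr//; split.
  have supV : has_sup V.
    split; first by exists 0.
    exists t => _ [D [[_ _ Dt] _] <-]; rewrite (le_trans _ Dt)// gerBl.
    by rewrite fine_ge0.
  have Vub D : ok D -> B `<=` D -> fine (P D) - fine (P B) <= sup V.
    by move=> okD BD; apply: ub_le_sup; [case: supV|exists D].
  have [s0|s0] := leP (sup V) 0.
    exists B => _; split => // D okD BD; rewrite subrr mulr0.
    exact: le_trans (Vub _ okD BD) _.
  have [_ [C [okC BC] <-] Cs] := sup_adherent (divr_gt0 s0 (@ltr0n R 2)) supV.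
  exists C => _; split => // D okD BD.
  by have := Vub _ okD BD; lra.
pose B := fix B n := if n is m.+1 then nx (B m) else set0.
have okB n : ok (B n).
  elim: n => [|n IH]; first by split; rewrite /= ?measure0.
  by have [] := nxP _ IH.
have BS n : B n `<=` B n.+1 by have [] := nxP _ (okB n).
have ndB : nondecreasing_seq B.
  apply/nondecreasing_seqP => n; exact/subsetPset/BS.
have mB n : measurable (B n) by have [] := okB n.
have mU : measurable (\bigcup_n B n) by exact: bigcupT_measurable.
have UA : \bigcup_n B n `<=` A by move=> x [n _]; have [_ + _] := okB n; exact.
have cvgPB : fine (P (B n)) @[n --> \oo] --> fine (P (\bigcup_n B n)).
  apply: fine_cvg; rewrite -PE//; apply: nondecreasing_cvg_mu => //.
have Ut : fine (P (\bigcup_n B n)) <= t.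
  rewrite -(cvg_lim _ cvgPB)//; apply: limr_le; first by apply: cvgP cvgPB.
  by apply: nearW => n; have [] := okB n.
exists (\bigcup_n B n); split => //; apply/eqP; rewrite eq_le Ut/=.
rewrite leNgt; apply/negP => Ut'.
set U := \bigcup_n B n in mU UA cvgPB Ut Ut'.
have mAU : measurable (A `\` U) by exact: measurableD.
have PAU : (0 < P (A `\` U))%E.
  rewrite measureD//; last by rewrite ltey_eq fin_num_measure.
  rewrite (_ : A `&` U = U); last exact/setIidPr.
  have PUA : (P U < P A)%E by rewrite PE// [ltRHS]PE// lte_fin; lra.
  by rewrite sube_gt0.
have [n hn] : exists n, 2^-1 ^+ n < t - fine (P U).
  have h : (fun n => 2^-1 ^+ n) @ \oo --> (0 : R).
    by apply: cvg_expr; rewrite ger0_norm//; lra.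
  have tU : 0 < t - fine (P U) by lra.
  have /cvgrPdist_lt/(_ _ tU)[N _ /(_ N (leqnn N))] := h.
  by rewrite sub0r normrN ger0_norm ?exprn_ge0// => ?; exists N.
have [C [mC CAU PC PCn]] := atomless_small n mAU PAU.
have PC' : 0 < fine (P C) by rewrite -lte_fin -PE.
(* [C] could have been added at each step, so the increments do not vanish *)
have incr m : fine (P C) <= 2 * (fine (P (B m.+1)) - fine (P (B m))).
  have [_ _ h] := nxP _ (okB m).
  have BC : [disjoint B m & C].
    apply/disj_setPS => x [Bx Cx].
    by have [_ []] := CAU _ Cx; exists m.
  have PBC : fine (P (B m `|` C)) = fine (P (B m)) + fine (P C).
    by rewrite measureU// ?fineD ?fin_num_measure//; apply/disj_set2P.
  have /(_ _ (@subsetUl _ _ _)) := h (B m `|` C).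
  rewrite PBC addrAC subrr add0r; apply; split.
  - exact: measurableU.
  - by rewrite subUset; split; [have [] := okB m|move=> x /CAU[]].
  - have BU : fine (P (B m)) <= fine (P U).
      by rewrite fine_le ?fin_num_measure// le_measure ?inE//; exact: bigcup_sup.
    by rewrite PBC; lra.
have c0 : (fine (P (B n.+1)) - fine (P (B n))) @[n --> \oo] --> 0.
  rewrite -[X in _ --> X](subrr (fine (P U))); apply: cvgB => //.
  by rewrite (cvg_shiftS (fun n => fine (P (B n)))).
have PC2 : 0 < fine (P C) / 2 by lra.
have /cvgrPdist_lt/(_ _ PC2)[N _ /(_ N (leqnn N))] := c0.
by rewrite sub0r normrN; have := incr N; have := ler_norm (fine (P (B N.+1)) - fine (P (B N))); lra.
Qed.

(** An event splits into finitely many events of prescribed probabilities. *)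
Lemma atomless_partition (k : nat) (A : set Omega) (q : 'I_k.+1 -> R) :
  measurable A -> (forall i, 0 <= q i) -> \sum_i q i = fine (P A) ->
  exists B : 'I_k.+1 -> set Omega,
    [/\ forall i, measurable (B i), forall i, fine (P (B i)) = q i,
        trivIset setT B & \bigcup_i B i = A].
Proof.
elim: k A q => [|k IH] A q mA q0 qA.
  exists (fun=> A); split => //.
  - by move=> i; rewrite -qA big_ord1 (ord1 i).
  - by move=> i j _ _ _; rewrite (ord1 i) (ord1 j).
  - by rewrite bigcup_const//; exists ord0.
rewrite big_ord_recl in qA.
have [|B0 [mB0 B0A PB0]] := @atomless_subset A (q ord0) mA (q0 _).
  by rewrite -qA lerDl sumr_ge0.
have PAB : fine (P (A `\` B0)) = fine (P A) - fine (P B0).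
  rewrite measureD//; last by rewrite ltey_eq fin_num_measure.
  by rewrite (_ : A `&` B0 = B0) ?fineB ?fin_num_measure//; exact/setIidPr.
have mAB0 : measurable (A `\` B0) by exact: measurableD.
have [//||B [mB PB tB UB]] := IH _ (fun i => q (lift ord0 i)) mAB0.
  by rewrite PAB PB0 -qA addrAC subrr add0r.
have BA i : B i `<=` A `\` B0 by rewrite -UB; exact: bigcup_sup.
exists (fun i => if unlift ord0 i is Some j then B j else B0); split.
- by move=> i; case: unliftP.
- by move=> i; case: unliftP => [j|] ->.
- move=> i j _ _; case: unliftP => [i'|] ->; case: unliftP => [j'|] -> //.
  + by move=> h; congr lift; apply: tB.
  + by move=> [x [/BA[]]].
  + by move=> [x [] + /BA[]].
- apply/seteqP; split.
    by move=> x [i _]; case: unliftP => [j|] _; [move/BA => []|exact: B0A].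
  move=> x Ax; have [B0x|nB0x] := pselect (B0 x).
    by exists ord0 => //; rewrite unlift_none.
  have : (A `\` B0) x by [].
  by rewrite -UB => -[j _ Bj]; exists (lift ord0 j) => //; rewrite liftK.
Qed.

End atomless.

(** * A one-sided strong law of large numbers *)

Section random_variables.
Context {d : measure_display} {Omega : measurableType d} {R : realType}.
Variable P : probability Omega R.

(** The random variable given by a measurable function. *)
Definition rv_of (f : Omega -> R) (mf : measurable_fun setT f) : {RV P >-> R} :=
  HB.pack f (isMeasurableFun.Build _ _ _ _ f mf).

Lemma measurable_set_ler (f g : Omega -> R) : measurable_fun setT f ->
  measurable_fun setT g -> measurable [set w | f w <= g w].
Proof.
move=> mf mg; rewrite -[X in measurable X]setTI.
by apply: (measurable_fun_ler mf mg measurableT (Y := [set true])).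
Qed.

Lemma measurable_set_ltr (f g : Omega -> R) : measurable_fun setT f ->
  measurable_fun setT g -> measurable [set w | f w < g w].
Proof.
move=> mf mg; rewrite -[X in measurable X]setTI.
by apply: (measurable_fun_ltr mf mg measurableT (Y := [set true])).
Qed.

Lemma bounded_Lfun2 (Y : Omega -> R) (M : R) : measurable_fun setT Y ->
  (forall w, `|Y w| <= M) -> Y \in Lfun P 2%:E.
Proof.
move=> mY YM; rewrite inE; apply/andP; split; rewrite inE//=.
rewrite /finite_norm unlock poweR_lty//.
have M0 : 0 <= M by exact: le_trans (YM point).
apply: (@le_lt_trans _ _ (\int[P]_w (M `^ 2)%:E)%E); last first.
  by rewrite integral_cst//= probability_setT mule1 ltry.
apply: ge0_le_integral => //.
- by move=> x _; rewrite lee_fin powR_ge0.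
- apply/measurable_EFinP; apply: (measurableT_comp (measurable_powR _)).
  exact: measurableT_comp.
- by move=> x _; rewrite lee_fin ge0_ler_powR// nnegrE.
Qed.

Lemma Lfun2_Lfun1 (Y : Omega -> R) : Y \in Lfun P 2%:E -> Y \in Lfun P 1.
Proof. by apply: Lfun_subset12; exact: fin_num_measure. Qed.

End random_variables.

Section pairwise_independence.
Context {d : measure_display} {Omega : measurableType d} {R : realType}.
Variable P : probability Omega R.
Variable X : nat -> {RV P >-> R}.
Hypothesis indepX : independent_seq X.

Lemma independent_seq_pair i j (A B : set R) : i != j ->
  measurable A -> measurable B ->
  P (X i @^-1` A `&` X j @^-1` B) = (P (X i @^-1` A) * P (X j @^-1` B))%E.
Proof.
move=> ij mA mB.
have := @indepX [fset i; j]%fset (fun n => if n == i then A else B).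
rewrite big_fsetU1/=; last by rewrite inE.
rewrite big_seq_fset1 eqxx eq_sym (negbTE ij) => <-; last by move=> n; case: ifP.
congr (P _); apply/seteqP; split => w /=.
  by move=> [Aw Bw] n /=; rewrite !inE => /orP[|] /eqP ->; rewrite ?eqxx// eq_sym (negbTE ij).
move=> h; split.
  by have := h i; rewrite /= eqxx; apply; rewrite !inE eqxx.
by have := h j; rewrite /= eq_sym (negbTE ij); apply; rewrite !inE eqxx orbT.
Qed.

(** Factorisation of expectations: the joint law of two members of the sequence
    is the product of their laws, to which Tonelli's theorem applies. *)
Lemma independent_seq_expectationM i j (f g : R -> R) : i != j ->
  measurable_fun setT f -> measurable_fun setT g ->
  (forall x, 0 <= f x) -> (forall x, 0 <= g x) ->
  (\int[P]_w (f (X i w) * g (X j w))%:E =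
   \int[P]_w (f (X i w))%:E * \int[P]_w (g (X j w))%:E)%E.
Proof.
move=> ij mf mg f0 g0.
have mX n : measurable_fun setT (X n) by [].
have mXX : measurable_fun setT (fun w => (X i w, X j w)) by exact: measurable_fun_pair.
pose F (z : R * R) := (f z.1 * g z.2)%:E.
have mF : measurable_fun setT F.
  apply/measurable_EFinP; apply: measurable_funM.
    by apply: (measurableT_comp mf); exact: measurable_fst.
  by apply: (measurableT_comp mg); exact: measurable_snd.
have F0 z : (0 <= F z)%E by rewrite lee_fin mulr_ge0.
pose m' := pushforward P (fun w => (X i w, X j w)).
transitivity (\int[m']_z F z)%E.
  by rewrite ge0_integral_pushforward.
transitivity (\int[distribution P (X i) \x distribution P (X j)]_z F z)%E.
  apply: eq_measure_integral => A mA _; apply/esym.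
  apply: (@product_measure_unique _ _ _ _ _ (distribution P (X i)) (distribution P (X j)) (pushforward P (fun w => (X i w, X j w)))) => //.
  by move=> B C mB mC; rewrite /= /pushforward/=; exact: independent_seq_pair.
rewrite fubini_tonelli1//.
transitivity (\int[distribution P (X i)]_x ((f x)%:E * \int[P]_w (g (X j w))%:E))%E.
  apply: eq_integral => x _; rewrite /fubini_F/=.
  transitivity (\int[distribution P (X j)]_y ((f x)%:E * (g y)%:E))%E => //.
  rewrite ge0_integralZl//=.
  - by rewrite ge0_integral_distribution//=; exact/measurable_EFinP.
  - exact/measurable_EFinP.
  - by move=> y _; rewrite lee_fin.
  - by rewrite lee_fin.
rewrite ge0_integralZr//=.
- by rewrite ge0_integral_distribution//=; exact/measurable_EFinP.
- exact/measurable_EFinP.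
- by move=> y _; rewrite lee_fin.
- by apply: integral_ge0 => w _; rewrite lee_fin.
Qed.

(** Chebyshev's inequality for the mean of a bounded nonnegative function over
    the sample: the covariances vanish, so that the variance of a sum of [n]
    terms is at most [n] times the second moment. *)
Lemma chebyshev_sample_mean (xi : {RV P >-> R}) (g : R -> R) (M : R) n (eps : R) :
  (forall n, has_law (X n) (distribution P xi)) ->
  measurable_fun setT g -> (forall x, 0 <= g x) -> (forall x, g x <= M) ->
  0 < eps -> (0 < n)%N ->
  (P [set w | n%:R * (fine (\int[P]_w (g (xi w))%:E) + eps) <=
        \sum_(i < n) g (X i w)]%R <=
   ((n%:R * eps ^+ 2)^-1)%:E * \int[P]_w (g (xi w) ^+ 2)%:E)%E.
Proof.
move=> lawX mg g0 gM eps0 n0.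
have inteq (h : R -> R) : measurable_fun setT h -> (forall x, 0 <= h x) ->
    forall i, (\int[P]_w (h (X i w))%:E = \int[P]_w (h (xi w))%:E)%E.
  move=> mh h0 i.
  have mh' : measurable_fun setT (fun x => (h x)%:E) by exact/measurable_EFinP.
  rewrite -(@ge0_integral_distribution _ _ _ _ _ P (X i) _ mh')//=.
  rewrite -(@ge0_integral_distribution _ _ _ _ _ P xi _ mh')//=.
  by apply: eq_measure_integral => A mA _; exact: lawX.
pose Y i w := g (X i w).
have mY i : measurable_fun setT (Y i) by exact: measurableT_comp.
have Y2 i : Y i \in Lfun P 2%:E.
  by apply: (@bounded_Lfun2 _ _ _ _ _ M) => // w; rewrite /Y ger0_norm.
pose T k w := \sum_(i < k) Y i w.
have TS k : T k.+1 = (T k \+ Y k) by apply/funext => w; rewrite /T big_ord_recr.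
have T0 : T 0%N = cst 0 by apply/funext => w; rewrite /T big_ord0.
have T2 k : T k \in Lfun P 2%:E.
  elim: k => [|k IH]; first by rewrite T0; exact: Lfun_cst.
  by rewrite TS rpredD// lee1n.
have mT k : measurable_fun setT (T k).
  by elim: k => [|k IH]; [rewrite T0|rewrite TS; exact: measurable_funD].
have EY i : ('E_P[Y i] = (fine (\int[P]_w (g (xi w))%:E))%:E)%E.
  have := expectation_fin_num (Lfun2_Lfun1 (Y2 i)).
  by rewrite unlock inteq// => /fineK ->.
have ET k : ('E_P[T k] = (k%:R * fine (\int[P]_w (g (xi w))%:E))%:E)%E.
  elim: k => [|k IH]; first by rewrite T0 expectation_cst mul0r.
  rewrite TS expectationD ?Lfun2_Lfun1// IH EY -EFinD.
  by rewrite -natr1 mulrDl mul1r.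
have covY i j : i != j -> covariance P (Y i) (Y j) = 0%E.
  move=> ij; rewrite covarianceE; [|exact: Lfun2_Lfun1|exact: Lfun2_Lfun1|exact: Lfun2_mul_Lfun1].
  have -> : ('E_P[(Y i * Y j)%R] = 'E_P[Y i] * 'E_P[Y j])%E.
    by rewrite unlock; apply: independent_seq_expectationM.
  by rewrite subee// fin_numM ?expectation_fin_num ?Lfun2_Lfun1.
have covT k j : (k <= j)%N -> covariance P (T k) (Y j) = 0%E.
  elim: k => [|k IH] kj; first by rewrite T0 covariance_cst_l.
  by rewrite TS covarianceDl// IH ?(ltnW kj)// covY ?adde0// neq_ltn kj.
have VY i : ('V_P[Y i] <= \int[P]_w (g (xi w) ^+ 2)%:E)%E.
  rewrite varianceE// -(inteq (fun x => g x ^+ 2) _ _ i) /=; last 2 first.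
    exact: measurable_funX.
    by move=> x; exact: sqr_ge0.
  rewrite -[leRHS]sube0; apply: leeB; first by rewrite unlock.
  by rewrite EY -EFinM lee_fin -expr2 sqr_ge0.
have VT k : ('V_P[T k] <= k%:R%:E * \int[P]_w (g (xi w) ^+ 2)%:E)%E.
  elim: k => [|k IH]; first by rewrite T0 variance_cst mul0e.
  rewrite TS varianceD// covT// mule0 adde0 -natr1 EFinD ge0_muleDl ?lee_fin//.
  by rewrite mul1e leeD.
have nr0 : 0 < n%:R :> R by rewrite ltr0n.
have ne0 : 0 < n%:R * eps by rewrite mulr_gt0.
have := @chebyshev _ _ _ P (rv_of P (mT n)) _ ne0.
rewrite [(rv_of P (mT n) : Omega -> R)]/(T n) ET/= => cheb.
apply: (@le_trans _ _ (((n%:R * eps) ^- 2)%:E * (n%:R%:E * \int[P]_w (g (xi w) ^+ 2)%:E))%E).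
  apply: (le_trans _ (le_trans cheb _)); last first.
    by rewrite lee_pmul2l ?VT// lte_fin invr_gt0 exprn_gt0.
  have mgen (a : R) : measurable [set w | a <= T n w].
    exact: measurable_set_ler.
  apply: le_measure; rewrite ?inE.
  - exact: mgen.
  - apply: measurable_set_ler => //.
    apply: measurableT_comp => //; apply: measurable_funB => //; exact: mT.
  - move=> w /= h; apply: le_trans (ler_norm _).
    by move: h; rewrite mulrDr /T; lra.
rewrite muleA -EFinM le_eqVlt; apply/orP; left; apply/eqP; congr (_%:E * _)%E.
by field; rewrite gt_eqF//= gt_eqF.
Qed.

End pairwise_independence.

Section slln.
Context {R : realType}.

(** The two dyadic sums controlling a truncation at level [2 ^ j]: the excess
    over the levels, and the second moments below the levels. *)
Lemma dyadic_sum_above (y : R) J : 0 <= y ->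
  \sum_(j < J) (if y <= 2 ^+ j then 0 else 2 ^+ j) <= 2 * y.
Proof.
move=> y0.
have le2 K : \sum_(j < K) (if y <= 2 ^+ j then 0 else 2 ^+ j) <= 2 ^+ K :> R.
  elim: K => [|K IH]; first by rewrite big_ord0 expr0.
  rewrite big_ord_recr exprS/=; have := exprn_ge0 K (@ler0n R 2).
  by case: ifP => _; lra.
elim: J => [|J IH]; first by rewrite big_ord0; lra.
rewrite big_ord_recr/=; have [h|h] := leP y (2 ^+ J); first by rewrite addr0.
by have := le2 J; lra.
Qed.

Lemma dyadic_sum_below (y : R) J : 0 <= y ->
  \sum_(j < J) (if y <= 2 ^+ j then 2^-1 ^+ j * y ^+ 2 else 0) <= 2 * y.
Proof.
move=> y0.
suff h : \sum_(j < J) (if y <= 2 ^+ j then 2^-1 ^+ j * y ^+ 2 else 0) <=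
    (if y <= 2 ^+ J then 2 * y - 2 * (2^-1 ^+ J * y ^+ 2) else 0).
  apply: (le_trans h); case: ifP => _; last by lra.
  have : 0 <= 2^-1 ^+ J * y ^+ 2 by rewrite mulr_ge0 ?exprn_ge0.
  by lra.
have y2 K : y <= 2 ^+ K -> 2^-1 ^+ K * y ^+ 2 <= y.
  by move=> yK; rewrite exprVn ler_pdivrMl ?exprn_gt0// expr2 ler_wpM2r.
elim: J => [|J IH].
  rewrite big_ord0; case: ifP => // h; have := y2 0%N h.
  by rewrite expr0 mul1r; lra.
rewrite big_ord_recr/=; have := y2 J.
have -> : 2^-1 ^+ J.+1 * y ^+ 2 = 2^-1 * (2^-1 ^+ J * y ^+ 2) :> R.
  by rewrite exprS mulrA.
have JJ : 2 ^+ J.+1 = 2 * 2 ^+ J :> R by rewrite exprS.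
have J0 := exprn_ge0 J (@ler0n R 2).
move: IH; set s := \sum_(_ < _) _; set u := 2^-1 ^+ J * _.
case: (leP y (2 ^+ J)) => [yJ|yJ] IH.
  move=> /(_ isT) uy; case: (leP y (2 ^+ J.+1)) => yJ'; last first.
    by exfalso; lra.
  by lra.
move=> _; case: (leP y (2 ^+ J.+1)) => yJ'; last by rewrite addr0.
have := y2 J.+1 yJ'; rewrite exprS -mulrA -/u; lra.
Qed.

Context {d : measure_display} {Omega : measurableType d}.
Variable P : probability Omega R.
Variables (X : nat -> {RV P >-> R}) (xi : {RV P >-> R}).
Hypothesis indepX : independent_seq X.
Hypothesis lawX : forall n, has_law (X n) (distribution P xi).
Variable f : R -> R.
Hypothesis mf : measurable_fun setT f.
Hypothesis f0 : forall x, 0 <= f x.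
Hypothesis intf : (\int[P]_w (f (xi w))%:E < +oo)%E.

Let e := fine (\int[P]_w (f (xi w))%:E).

Let eE : (\int[P]_w (f (xi w))%:E)%E = e%:E.
Proof.
rewrite /e fineK// ge0_fin_numE//.
by apply: integral_ge0 => w _; rewrite lee_fin.
Qed.

(* The truncation of [f] at level [2 ^+ j] is [g j]; up to constants, [a j]
   accounts for the truncated part and [b j] for the variance of [g j]. *)
Let a j x : R := if f x <= 2 ^+ j then 0 else 2 ^+ j.
Let g j x : R := if f x <= 2 ^+ j then f x else 0.
Let b j x : R := if f x <= 2 ^+ j then 2^-1 ^+ j * f x ^+ 2 else 0.

Let measurable_if (c : R) (h1 h2 : R -> R) : measurable_fun setT h1 ->
  measurable_fun setT h2 ->
  measurable_fun setT (fun x => if f x <= c then h1 x else h2 x).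
Proof.
by move=> m1 m2; apply: measurable_fun_ifT => //; exact: measurable_fun_ler.
Qed.

Let ma j : measurable_fun setT (a j). Proof. exact: measurable_if. Qed.
Let mg j : measurable_fun setT (g j). Proof. exact: measurable_if. Qed.
Let mb j : measurable_fun setT (b j).
Proof.
apply: measurable_if => //; apply: measurable_funM => //.
exact: measurable_funX.
Qed.

Let a0 j x : 0 <= a j x. Proof. by rewrite /a; case: ifP => // _; rewrite exprn_ge0. Qed.
Let g0 j x : 0 <= g j x. Proof. by rewrite /g; case: ifP. Qed.
Let b0 j x : 0 <= b j x.
Proof. by rewrite /b; case: ifP => // _; rewrite mulr_ge0 ?exprn_ge0. Qed.

Let mexceed j : measurable [set x | 2 ^+ j < f x].
Proof. exact: measurable_set_ltr. Qed.

(** A sample sum of size [r * 2 ^ j] which is too large either contains a term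
    exceeding [2 ^+ j], or coincides with the sum of the truncated terms, which
    is then too large. *)
Lemma dyadic_deviation (r : nat) (eps : R) (j : nat) : (0 < r)%N -> 0 < eps ->
  (P [set w | (r * 2 ^ j)%:R * (e + eps) < \sum_(i < r * 2 ^ j) f (X i w)]%R <=
   \int[P]_w (r%:R * a j (xi w) + (r%:R * eps ^+ 2)^-1 * b j (xi w))%:E)%E.
Proof.
move=> r0 eps0; set n := (r * 2 ^ j)%N.
have n0 : (0 < n)%N by rewrite muln_gt0 r0 expn_gt0.
have nE : n%:R = r%:R * 2 ^+ j :> R by rewrite natrM natrX.
pose B i := X i @^-1` [set x | 2 ^+ j < f x].
have mB i : measurable (B i) by apply: measurable_funPTI; exact: mexceed.
have PB i : P (B i) = P (xi @^-1` [set x | 2 ^+ j < f x]) by apply: lawX; exact: mexceed.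
pose D := [set w | n%:R * (fine (\int[P]_w (g j (xi w))%:E) + eps) <=
  \sum_(i < n) g j (X i w)].
have mD : measurable D.
  apply: measurable_set_ler => //; apply: measurable_sum => i.
  exact: measurableT_comp.
have eg : fine (\int[P]_w (g j (xi w))%:E) <= e.
  apply: fine_le.
  - rewrite ge0_fin_numE; last by apply: integral_ge0 => w _; rewrite lee_fin.
    apply: le_lt_trans intf; apply: ge0_le_integral => //.
    + by move=> w _; rewrite lee_fin.
    + by apply/measurable_EFinP; exact: measurableT_comp.
    + by apply/measurable_EFinP; exact: measurableT_comp.
    + by move=> w _; rewrite lee_fin /g; case: ifP.
  - by rewrite eE.
  - apply: ge0_le_integral => //.
    + by move=> w _; rewrite lee_fin.
    + by apply/measurable_EFinP; exact: measurableT_comp.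
    + by apply/measurable_EFinP; exact: measurableT_comp.
    + by move=> w _; rewrite lee_fin /g; case: ifP.
apply: (@le_trans _ _ (P (\big[setU/set0]_(i < n) B i `|` D))).
  apply: le_measure; rewrite ?inE.
  - apply: measurable_set_ltr => //; apply: measurable_sum => i.
    exact: measurableT_comp.
  - by apply: measurableU => //; exact: bigsetU_measurable.
  - move=> w /= fw.
    have [Bw|nBw] := pselect ((\big[setU/set0]_(i < n) B i) w); [by left|right].
    have fg (i : 'I_n) : f (X i w) = g j (X i w).
      rewrite /g; case: leP => // h; exfalso; apply: nBw.
      by rewrite -bigcup_mkord; exists i => //=.
    rewrite /D/= -(eq_bigr _ (fun i _ => fg i)); apply: le_trans (ltW fw).
    by rewrite ler_wpM2l// lerD2r.
apply: (le_trans (measureU2 _ _ _)) => //; first exact: bigsetU_measurable.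
have intaE : (\int[P]_w (a j (xi w))%:E =
    (2 ^+ j)%:E * P (xi @^-1` [set x | 2 ^+ j < f x]%R))%E.
  rewrite -integral_cst//; last first.
    by apply: measurable_funPTI; exact: mexceed.
  rewrite [RHS]integral_mkcond; apply: eq_integral => w _.
  rewrite patchE /a; case: ifPn => [h|h].
    by rewrite memNset//= => h'; move: h; rewrite leNgt h'.
  by rewrite mem_set//= ltNge.
have intbE : (\int[P]_w (b j (xi w))%:E =
    (2^-1 ^+ j)%:E * \int[P]_w (g j (xi w) ^+ 2)%:E)%E.
  rewrite -ge0_integralZl_EFin//.
  - apply: eq_integral => w _; rewrite -EFinM; congr _%:E.
    by rewrite /b /g; case: ifP => // _; rewrite expr0n mulr0.
  - by move=> w _; rewrite lee_fin sqr_ge0.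
  - apply/measurable_EFinP; apply: measurable_funX; exact: measurableT_comp.
have gM x : g j x <= 2 ^+ j by rewrite /g; case: ifP => // _; rewrite exprn_ge0.
have re0 : 0 <= (r%:R * eps ^+ 2)^-1 by rewrite invr_ge0 mulr_ge0 ?sqr_ge0.
have maxi : measurable_fun setT (fun w => (a j (xi w))%:E).
  by apply/measurable_EFinP; exact: measurableT_comp.
have mbxi : measurable_fun setT (fun w => (b j (xi w))%:E).
  by apply/measurable_EFinP; exact: measurableT_comp.
under eq_integral do rewrite EFinD 2!EFinM.
rewrite ge0_integralD//=; first last.
- exact: measurable_funeM.
- by move=> w _; rewrite mule_ge0 ?lee_fin.
- exact: measurable_funeM.
- by move=> w _; rewrite mule_ge0 ?lee_fin.
rewrite !ge0_integralZl_EFin//; first last.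
- by move=> w _; rewrite lee_fin.
- by move=> w _; rewrite lee_fin.
apply: leeD.
  apply: (@le_trans _ _ (\sum_(i < n) P (xi @^-1` [set x | 2 ^+ j < f x]%R))%E).
    apply: (le_trans (Boole_inequality P (fun i _ => mB i))).
    by apply: lee_sum => i _; rewrite le_eqVlt; apply/orP; left; apply/eqP; exact: PB.
  rewrite intaE muleA -EFinM -nE -(@fineK _ (P _)).
    by rewrite sumEFin sumr_const card_ord -EFinM mulr_natl.
  by rewrite fin_num_measure//; apply: measurable_funPTI; exact: mexceed.
apply: (le_trans (chebyshev_sample_mean indepX lawX (mg j) (g0 j) gM eps0 n0)).
rewrite intbE muleA -EFinM le_eqVlt; apply/orP; left; apply/eqP.
congr (_%:E * _)%E; rewrite nE exprVn -invfM; congr (_^-1).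
by rewrite mulrAC.
Qed.

(** For fixed [r], summing over [j] turns [a j] and [b j] into at most [2 * f]
    each, whose expectation is finite. *)
Lemma dyadic_deviation_summable (r : nat) (eps : R) : (0 < r)%N -> 0 < eps ->
  (\sum_(0 <= j <oo)
     P [set w | (r * 2 ^ j)%:R * (e + eps) < \sum_(i < r * 2 ^ j) f (X i w)]%R
   < +oo)%E.
Proof.
move=> r0 eps0; set k := (r%:R * eps ^+ 2)^-1.
have k0 : 0 <= k by rewrite invr_ge0 mulr_ge0 ?sqr_ge0.
apply: (@le_lt_trans _ _ ((2 * r%:R + 2 * k) * e)%:E); last exact: ltry.
apply: lime_le; first by apply: is_cvg_nneseries.
apply: nearW => J; rewrite big_mkord.
apply: (@le_trans _ _ (\sum_(j < J) \int[P]_w (r%:R * a j (xi w) + k * b j (xi w))%:E)%E).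
  by apply: lee_sum => j _; exact: dyadic_deviation.
have mc j : measurable_fun setT (fun w => (r%:R * a j (xi w) + k * b j (xi w))%:E).
  apply/measurable_EFinP; apply: measurable_funD; apply: measurable_funM => //;
  exact: measurableT_comp.
have c0 j w : (0 <= (r%:R * a j (xi w) + k * b j (xi w))%:E)%E.
  by rewrite lee_fin addr_ge0// mulr_ge0.
rewrite -ge0_integral_sum//.
rewrite EFinM -eE -ge0_integralZl_EFin//; first last.
- by rewrite addr_ge0// mulr_ge0.
- by apply/measurable_EFinP; exact: measurableT_comp.
- by move=> w _; rewrite lee_fin.
apply: ge0_le_integral => //.
- by move=> w _; exact: sume_ge0.
- exact: emeasurable_sum.
- by apply: measurable_funeM; apply/measurable_EFinP; exact: measurableT_comp.
move=> w _; rewrite sumEFin -EFinM lee_fin big_split/= -!mulr_sumr mulrDl.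
have A := dyadic_sum_above J (f0 (xi w)).
have B := dyadic_sum_below J (f0 (xi w)).
by apply: lerD; rewrite [2 * _]mulrC -[leRHS]mulrA ler_wpM2l.
Qed.

(** From the sizes [r * 2 ^ j] to all sample sizes: two consecutive multiples of
    [2 ^ j] which are at least [r * 2 ^ j] have a ratio close to [1] if [r] is
    large. *)
Lemma dyadic_interpolation (s : nat -> R) : {homo s : m n / (m <= n)%N >-> m <= n} ->
  (forall r k, \forall j \near \oo,
     s (r.+1 * 2 ^ j)%N <= (r.+1 * 2 ^ j)%:R * (e + k.+1%:R^-1)) ->
  forall delta, 0 < delta -> \forall N \near \oo, s N <= N%:R * (e + delta).
Proof.
move=> nds hs delta delta0.
have e0 : 0 <= e by rewrite -lee_fin -eE integral_ge0// => w _; rewrite lee_fin.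
pose k := Num.truncn (2 / delta).
have k1 : k.+1%:R^-1 <= delta / 2 :> R.
  rewrite -[leRHS]invrK lef_pV2 ?posrE ?invr_gt0 ?divr_gt0// invf_div.
  exact/ltW/truncnS_gt.
pose r := (Num.truncn ((e + delta / 2) / (delta / 2))).+1.
have r0 : 0 < r%:R :> R by rewrite ltr0n.
have hr : (e + delta / 2) / r%:R <= delta / 2.
  rewrite ler_pdivrMr// -ler_pdivrMl ?divr_gt0// [leLHS]mulrC.
  exact/ltW/truncnS_gt.
have [J hJ] : exists J, forall q j, (q < r)%N -> (J <= j)%N ->
    s ((r + q).+1 * 2 ^ j)%N <= ((r + q).+1 * 2 ^ j)%:R * (e + k.+1%:R^-1).
  have : \forall j \near \oo, forall q : 'I_r,
      s ((r + q).+1 * 2 ^ j)%N <= ((r + q).+1 * 2 ^ j)%:R * (e + k.+1%:R^-1).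
    by apply: filter_forall => q; exact: hs.
  move=> [J _ hJ]; exists J => q j qr Jj.
  exact: (hJ j Jj (Ordinal qr)).
(* a size [N] lies between [q * 2 ^ j] and [q.+1 * 2 ^ j] with [r <= q < 2 r] *)
exists (r * 2 ^ J)%N => // N /= rN.
have r_gt0 : (0 < r)%N by [].
have Nr0 : (0 < N %/ r)%N.
  by rewrite divn_gt0// (leq_trans _ rN)// leq_pmulr// expn_gt0.
pose j := trunc_log 2 (N %/ r).
have /andP[j1 j2] := trunc_log_bounds (ltnSn 1) Nr0.
rewrite -/j in j1 j2.
rewrite leq_divRL// in j1; rewrite ltn_divLR// in j2.
have Jj : (J <= j)%N.
  by apply: trunc_log_max => //; rewrite leq_divRL// mulnC.
have p0 : (0 < 2 ^ j)%N by rewrite expn_gt0.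
pose q := (N %/ 2 ^ j)%N.
have qN : (q * 2 ^ j <= N)%N by exact: leq_trunc_div.
have Nq : (N < q.+1 * 2 ^ j)%N by rewrite -ltn_divLR.
have rq : (r <= q)%N by rewrite leq_divRL// mulnC.
have qr : (q - r < r)%N.
  by rewrite ltn_subLR// ltn_divLR// addnn -muln2 -mulnA mulnC -expnS.
have := hJ (q - r)%N j qr Jj; rewrite subnKC// => hq.
have q0 : 0 < q%:R :> R by rewrite ltr0n (leq_trans _ rq).
apply: (le_trans (nds _ _ (ltnW Nq))); apply: (le_trans hq).
apply: (@le_trans _ _ ((q.+1 * 2 ^ j)%:R * (e + delta / 2))).
  by rewrite ler_wpM2l// lerD2l.
apply: (@le_trans _ _ ((q * 2 ^ j)%:R * (e + delta))); last first.
  by rewrite ler_wpM2r ?ler_nat// addr_ge0// ltW.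
rewrite !natrM mulrAC [leRHS]mulrAC ler_wpM2r//.
rewrite -natr1 mulrDl mul1r.
have h1 : e + delta / 2 <= r%:R * (delta / 2) by rewrite [leRHS]mulrC -ler_pdivrMr.
have h2 : r%:R * (delta / 2) <= q%:R * (delta / 2).
  by rewrite ler_wpM2r ?ler_nat// divr_ge0// ltW.
have -> : e + delta = (e + delta / 2) + delta / 2 by rewrite -addrA -splitr.
by rewrite [leRHS]mulrDr lerD2l; exact: le_trans h2.
Qed.

(** Almost surely, the sample means are asymptotically at most the mean. *)
Lemma slln_upper : {ae P, forall w, forall delta, 0 < delta ->
  \forall N \near \oo, \sum_(i < N) f (X i w) <= N%:R * (e + delta)}.
Proof.
pose F r k j := [set w |
  (r.+1 * 2 ^ j)%:R * (e + k.+1%:R^-1) < \sum_(i < r.+1 * 2 ^ j) f (X i w)].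
have mF r k j : measurable (F r k j).
  apply: measurable_set_ltr => //; apply: measurable_sum => i.
  exact: measurableT_comp.
have F0 r k : P (lim_sup_set (F r k)) = 0%E.
  by apply: lim_sup_set_cvg0 => //; apply: dyadic_deviation_summable => //; rewrite invr_gt0.
have : {ae P, forall w, forall r k, ~ lim_sup_set (F r k) w}.
  apply: ae_foralln => r; apply: ae_foralln => k.
  exists (lim_sup_set (F r k)); split => //.
    apply: bigcap_measurable => // m _; apply: bigcup_measurable => j _.
    exact: mF.
    exact: F0.
  by move=> w /= /contrapT.
apply: filterS => w hw; apply: dyadic_interpolation.
  move=> m n mn; rewrite -(subnKC mn) big_split_ord/= lerDl.
  by apply: sumr_ge0 => i _; exact: f0.
move=> r k; have := hw r k; rewrite /lim_sup_set /bigcap /=.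
move/existsNP => [N /not_implyP[_ hN]].
exists N => // j /= Nj; rewrite leNgt; apply/negP => h.
by apply: hN; exists j.
Qed.

End slln.

(** * Convex closed sets of densities in an Orlicz space *)

Section densities.
Context {d : measure_display} {Omega : measurableType d} {R : realType}.
Variable P : probability Omega R.
Variable S : set {RV P >-> R}.
Hypothesis S_density : S `<=` probability_density P.
Hypothesis S_closed : L1_closed S.

Let density_integrable h : S h -> P.-integrable setT (EFin \o h).
Proof. by move=> /S_density[h1 _ _]; exact/Lfun1_integrable. Qed.

Let mnorm (h : {RV P >-> R}) : measurable_fun setT (fun w => `|h w|%:E).
Proof. by apply/measurable_EFinP; exact: measurableT_comp. Qed.

Lemma density_norm1 h : S h -> (\int[P]_w `|h w|%:E = 1)%E.
Proof.
move=> /S_density[_ h0]; rewrite unlock => <-.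
apply: ae_eq_integral => //; first exact/measurable_EFinP.
by apply: filterS h0 => w h0 _; rewrite ger0_norm.
Qed.

Let rv_norm (h : {RV P >-> R}) : {RV P >-> R} :=
  rv_of P (measurableT_comp (@normr_measurable R setT) (measurable_funPT h)).

(** An [L1_closed] set contains the a.s. modifications of its members, and a
    density is a.s. equal to its absolute value. *)
Lemma L1_closed_norm h : S h -> S (rv_norm h).
Proof.
move=> Sh; apply: (S_closed (h_ := fun=> h)) => //.
  apply/Lfun1_integrable; have /integrableP[mh hoo] := density_integrable Sh.
  apply/integrableP; split; first by exact: mnorm.
  by under eq_integral do rewrite /= normr_id.
suff -> : ('N[P]_1[EFin \o (h \- rv_norm h)%R] = 0)%E by exact: cvg_cst.
rewrite Lnorm1; have [_ h0 _] := S_density Sh.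
rewrite (_ : 0%E = \int[P]_w cst 0%E w)%E; last by rewrite integral0.
apply: ae_eq_integral => //=.
  apply/measurable_EFinP; apply: measurableT_comp => //.
  by apply: measurable_funB => //; exact: measurableT_comp.
by apply: filterS h0 => w h0 _ /=; rewrite (ger0_norm h0) subrr normr0.
Qed.

Hypothesis S_convex : convex_set (S : set (convex_lmodType {mfun Omega >-> R})).

(** Truncated dyadic series of members are members once the last weight is
    doubled, which makes the weights sum to [1]. *)
Lemma dyadic_combination (k : nat -> {RV P >-> R}) n : (forall i, S (k i)) ->
  exists2 g, S g & forall w,
    g w = \sum_(i < n) 2^-1 ^+ i.+1 * k i w + 2^-1 ^+ n * k n w.
Proof.
elim: n k => [|n IH] k Sk.
  by exists (k 0%N) => // w; rewrite big_ord0 add0r expr0 mul1r.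
have [g Sg gE] := IH (fun i => k i.+1) (fun i => Sk i.+1).
have l01 : 0 <= (2^-1 : R) <= 1 by apply/andP; split; lra.
pose l : {i01 R} := Itv01 (elimT andP l01).1 (elimT andP l01).2.
exists (conv l (k 0%N : convex_lmodType {mfun Omega >-> R}) g).
  by apply/set_mem/S_convex; apply/mem_set.
move=> w; rewrite big_ord_recl /= -addrA expr1.
transitivity (2^-1 * k 0%N w + (1 - 2^-1) * g w) => //.
rewrite gE (_ : 1 - 2^-1 = 2^-1) ?mulrDr; last by lra.
congr (_ + _); rewrite mulr_sumr; congr (_ + _); last by rewrite exprS mulrA.
by apply: eq_bigr => i _; rewrite mulrA -exprS.
Qed.

(** The sum of a series of densities with dyadic weights belongs to the set up
    to an a.s. modification, and a.s. dominates each term. *)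
Lemma density_series (k : nat -> {RV P >-> R}) : (forall i, S (k i)) ->
  (forall i w, 0 <= k i w) ->
  exists2 H : {RV P >-> R}, S H &
    forall n, {ae P, forall w, 2^-1 ^+ n.+1 * k n w <= H w}.
Proof.
move=> Sk k0.
pose u i w := (2^-1 ^+ i.+1 * k i w)%:E.
have u0 i w : (0 <= u i w)%E by rewrite lee_fin mulr_ge0 ?exprn_ge0.
have mu i : measurable_fun setT (u i).
  by apply/measurable_EFinP; apply: measurable_funM.
have intk i : (\int[P]_w (k i w)%:E = 1)%E.
  by rewrite -(density_norm1 (Sk i)); apply: eq_integral => w _; rewrite ger0_norm.
have intu i : (\int[P]_w u i w = (2^-1 ^+ i.+1)%:E)%E.
  under eq_integral do rewrite /u EFinM.
  rewrite ge0_integralZl_EFin//= ?intk ?mule1 ?exprn_ge0//.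
    by move=> w _; rewrite lee_fin.
  exact/measurable_EFinP.
pose T n w := (\sum_(i <oo) u (i + n)%N w)%E.
have mT n : measurable_fun setT (T n).
  by apply: (@ge0_emeasurable_sum _ _ _ setT (fun i => u (i + n)%N)).
have T0 n w : (0 <= T n w)%E by apply: nneseries_ge0.
have intT n : (\int[P]_w T n w = (2^-1 ^+ n)%:E)%E.
  rewrite /T integral_nneseries//; under eq_eseriesr do rewrite intu.
  rewrite [in RHS]exprVn -[in RHS]div1r -(cvg_lim _ (@cvg_geometric_eseries_half R 1 n))//.
  apply: congr_lim; apply/funext => m; apply: eq_bigr => i _.
  by rewrite exprVn div1r addnS natrX.
have Tsplit n w : (T 0%N w = \sum_(i < n) u i w + T n w)%E.
  rewrite /T; under eq_eseriesr do rewrite addn0.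
  rewrite (nneseries_addn _ (fun i => u0 i w)) (@nneseries_split _ _ 0%N n)// add0n.
  by rewrite big_mkord.
(* the series may diverge on a negligible set, where [fine] yields [0] *)
pose Hf w := fine (T 0%N w).
have mH : measurable_fun setT Hf by exact: measurableT_comp.
pose H := rv_of P mH.
have Tfin : {ae P, forall w, T 0%N w \is a fin_num}.
  have : P.-integrable setT (T 0%N).
    apply/integrableP; split => //; under eq_integral do rewrite gee0_abs//.
    by rewrite intT ltry.
  by move/(integrable_ae measurableT); apply: filterS => w; exact.
have HE : {ae P, forall w, (H w)%:E = T 0%N w}.
  by apply: filterS Tfin => w; exact: fineK.
have H0 w : 0 <= H w by exact: fine_ge0.
exists H; last first.
  move=> n; apply: filterS HE => w Hw.
  rewrite -lee_fin Hw (Tsplit n.+1) big_ord_recr/= -addeA addeC -addeA.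
  by rewrite leeDl// adde_ge0// sume_ge0.
have [g gP] := choice (fun n => let: ex_intro2 g Sg gE := dyadic_combination n Sk in
  ex_intro (fun g => S g /\ _) g (conj Sg gE)).
apply: (S_closed (h_ := g)) => [n| |]; first by have [] := gP n.
  apply/Lfun1_integrable/integrableP; split; first exact/measurable_EFinP.
  apply: (@le_lt_trans _ _ (\int[P]_w T 0%N w)%E); last by rewrite intT ltry.
  apply: ae_ge0_le_integral => //; first by do 2 apply: measurableT_comp => //.
  by apply: filterS HE => w Hw _ /=; rewrite ger0_norm// -Hw.
have bnd n : ('N[P]_1[EFin \o (g n \- H)%R] <= (2^-1 ^+ n + 2^-1 ^+ n)%:E)%E.
  rewrite Lnorm1 EFinD -{2}intT.
  have -> : (2^-1 ^+ n)%:E = (\int[P]_w ((2^-1 ^+ n)%:E * (k n w)%:E))%E.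
    rewrite ge0_integralZl_EFin//= ?intk ?mule1 ?exprn_ge0//.
      by move=> w _; rewrite lee_fin.
    exact/measurable_EFinP.
  rewrite -ge0_integralD//=; first last.
  - apply: measurable_funeM; exact/measurable_EFinP.
  - by move=> w _; rewrite -EFinM lee_fin mulr_ge0 ?exprn_ge0.
  apply: ae_ge0_le_integral => //=.
  - apply/measurable_EFinP; apply: measurableT_comp => //.
    exact: measurable_funB.
  - by move=> w _; rewrite adde_ge0// -EFinM lee_fin mulr_ge0 ?exprn_ge0.
  - apply: emeasurable_funD => //; apply: measurable_funeM; exact/measurable_EFinP.
  apply: filterS HE => w Hw _; have [_ ->] := gP n.
  have := Hw; rewrite (Tsplit n) /u sumEFin.
  have := T0 n w; case: (T n w) => [t| |] //= t0 [->].
  rewrite -EFinM -EFinD !lee_fin in t0 *.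
  set s := \sum_(_ < _) _; set v := 2^-1 ^+ n * _.
  have v0 : 0 <= v by rewrite mulr_ge0 ?exprn_ge0.
  by rewrite ler_norml; apply/andP; split; lra.
apply: (@squeeze_cvge _ _ _ _ (cst 0%E) _ (fun n => (2^-1 ^+ n + 2^-1 ^+ n)%:E)).
- by apply: nearW => n; rewrite bnd Lnorm_ge0.
- exact: cvg_cst.
- apply: cvg_EFin; first exact: nearW.
  rewrite -[X in _ --> X](addr0 0); apply: cvgD;
    by apply: cvg_expr; rewrite ger0_norm//; lra.
Qed.

Variable phi : R -> R.
Hypothesis hphi : young_integrand phi.
Hypothesis S_orlicz : S `<=` orlicz_space P (young phi).
Local Notation Psi := (conjugate_young phi).

Let Psi_ge0 := conjugate_young_ge0 hphi.
Let mPsi : measurable_fun setT Psi := measurable_conjugate_young hphi measurableT.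

(** By Young's inequality, the pairing with an element of an Orlicz space is
    bounded on the unit ball of the conjugate one. *)
Lemma orlicz_pairing (h : {RV P >-> R}) : orlicz_space P (young phi) h ->
  exists C : R, forall Y : {RV P >-> R}, (forall w, 0 <= Y w) ->
    (\int[P]_w (Psi (Y w))%:E <= 1)%E ->
    (\int[P]_w (Y w * `|h w|)%:E <= C%:E)%E.
Proof.
move=> [k k0]; rewrite unlock => hk.
have Phi0 := young_nonneg (young_ge0 hphi) (young_nondecreasing hphi).
have mPhi := measurable_young (young_ge0 hphi) (young_nondecreasing hphi) measurableT.
have mPhih : measurable_fun setT (fun w => (young phi (k * h w))%:E).
  apply/measurable_EFinP; apply: (measurableT_comp mPhi).
  by apply: measurable_funM.
set I := (\int[P]_w (young phi (k * h w))%:E)%E in hk.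
have I0 : (0 <= I)%E by apply: integral_ge0 => w _; rewrite lee_fin.
exists (4 / k * (fine I + 1)) => Y Y0 YPsi.
have mY : measurable_fun setT Y by [].
have mPY : measurable_fun setT (fun w => (Psi (Y w))%:E).
  by apply/measurable_EFinP; exact: measurableT_comp.
have k4 : 0 <= 4 / k by rewrite divr_ge0// ltW.
apply: (@le_trans _ _ (\int[P]_w ((4 / k)%:E * ((young phi (k * h w))%:E + (Psi (Y w))%:E)))%E).
  apply: ge0_le_integral => //=.
  - by move=> w _; rewrite lee_fin mulr_ge0.
  - apply/measurable_EFinP; apply: measurable_funM => //.
    exact: measurableT_comp.
  - by apply: measurable_funeM; exact: emeasurable_funD.
  move=> w _; rewrite -EFinD -EFinM lee_fin.
  have x0 : 0 <= k * `|h w| / 2 by rewrite divr_ge0// mulr_ge0// ltW.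
  have y0 : 0 <= Y w / 2 by rewrite divr_ge0.
  have := young_inequality hphi x0 y0.
  have e2 (a : R) : 2 * (a / 2) = a by lra.
  rewrite !e2.
  rewrite -(young_norm _ (k * h w)) normrM (gtr0_norm k0) => yi.
  rewrite mulrAC ler_pdivlMr// (_ : _ * k = 4 * (k * `|h w| / 2 * (Y w / 2))); last by field.
  by rewrite ler_pM2l.
rewrite ge0_integralZl_EFin//=.
- rewrite ge0_integralD//=; last by move=> w _; rewrite lee_fin; exact: Psi_ge0.
  rewrite -/I [in leRHS]EFinM [in leRHS]EFinD lee_pmul2l ?lte_fin ?divr_gt0//.
  by rewrite fineK ?ge0_fin_numE// leeD.
- by move=> w _; rewrite lee_fin.
- by move=> w _; rewrite -EFinD lee_fin addr_ge0//; exact: Psi_ge0.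
- exact: emeasurable_funD.
Qed.

(** The set of densities is uniformly bounded on this unit ball: if the pairing
    of the [n]th density with a member of the ball were larger than
    [n.+1 * 2 ^+ n.+1] for each [n], then the dyadic series of these densities
    would be a member with an unbounded pairing. *)
Lemma densities_bounded : exists2 K : R, 0 < K &
  forall Y : {RV P >-> R}, (forall w, 0 <= Y w) ->
    (\int[P]_w (Psi (Y w))%:E <= 1)%E ->
    forall h, S h -> (\int[P]_w (Y w * `|h w|)%:E <= K%:E)%E.
Proof.
apply: contrapT => noK.
have bad (n : nat) : exists Yh : {RV P >-> R} * {RV P >-> R},
    [/\ forall w, 0 <= Yh.1 w, (\int[P]_w (Psi (Yh.1 w))%:E <= 1)%E, S Yh.2 &
      ((n.+1%:R * 2 ^+ n.+1)%:E < \int[P]_w (Yh.1 w * `|Yh.2 w|)%:E)%E].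
  apply: contrapT => h; apply: noK; exists (n.+1%:R * 2 ^+ n.+1).
    by rewrite mulr_gt0// exprn_gt0.
  move=> Y Y0 PY f Sf; rewrite leNgt; apply/negP => lt.
  by apply: h; exists (Y, f).
have [Yh YhP] := choice bad.
pose k n := rv_norm (Yh n).2.
have Sk n : S (k n) by apply: L1_closed_norm; have [] := YhP n.
have k0 n w : 0 <= k n w by exact: normr_ge0.
have [H SH Hk] := density_series Sk k0.
have [C HC] := orlicz_pairing (S_orlicz SH).
pose n := Num.truncn C.
have [Y0 PY _ big] := YhP n.
have := HC _ Y0 PY; apply/negP; rewrite -ltNge.
apply: (@lt_le_trans _ _ ((2^-1 ^+ n.+1)%:E * \int[P]_w ((Yh n).1 w * `|(Yh n).2 w|)%:E)%E).
  rewrite -lte_pdivrMl; last by rewrite exprn_gt0.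
  apply: le_lt_trans big; rewrite -EFinM lee_fin exprVn invrK mulrC.
  by rewrite ler_pM2r ?exprn_gt0//; exact/ltW/truncnS_gt.
have mYk : measurable_fun setT (fun w => ((Yh n).1 w * `|(Yh n).2 w|)%:E).
  apply/measurable_EFinP; apply: measurable_funM => //.
  exact: measurableT_comp.
rewrite -ge0_integralZl_EFin//=; first last.
- by move=> w _; rewrite lee_fin mulr_ge0.
apply: ae_ge0_le_integral => //=.
- by move=> w _; rewrite -EFinM lee_fin !mulr_ge0 ?exprn_ge0.
- exact: measurable_funeM.
- by move=> w _; rewrite lee_fin mulr_ge0.
- apply/measurable_EFinP; apply: measurable_funM => //.
  exact: measurableT_comp.
apply: filterS (Hk n) => w hw _; rewrite -EFinM lee_fin mulrCA ler_wpM2l//.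
exact: le_trans hw (ler_norm _).
Qed.

End densities.

(** * Coupling a law with an empirical measure *)

Section grid.
Context {R : realType}.

(** The index of the last cell of [grid_cell]. *)
Definition grid_size (M eps : R) : nat := (Num.truncn (2 * M / eps)).+2.

(** The index of the cell of [x] in a partition of the line into intervals: an
    unbounded cell on either side and, between them, cells of length [eps] that
    cover the interval from [- M] to [M].  The truncation of a negative number
    is [0], the index of the first cell. *)
Definition grid_cell (M eps x : R) : nat :=
  minn (Num.truncn ((x + M) / eps + 1)) (grid_size M eps).

Lemma grid_cell_le M eps x : (grid_cell M eps x <= grid_size M eps)%N.
Proof. exact: geq_minr. Qed.

Lemma measurable_grid_cell M eps i : 0 < eps ->
  measurable [set x : R | grid_cell M eps x = i].
Proof.
move=> eps0; apply: is_interval_measurable => x y /= cx cy z /andP[xz zy].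
have nd s t : s <= t -> (grid_cell M eps s <= grid_cell M eps t)%N.
  move=> st; rewrite leq_min !geq_min leqnn orbT andbT; apply/orP; left.
  by apply: le_truncn; rewrite lerD2r ler_pM2r ?invr_gt0// lerD2r.
by apply/eqP; rewrite eqn_leq -{1}cy nd// -cx nd.
Qed.

Lemma grid_cell_close M eps x y : 0 <= M -> 0 < eps -> `|x| <= M ->
  grid_cell M eps x = grid_cell M eps y -> `|x - y| <= eps.
Proof.
move=> M0 eps0; rewrite ler_norml => /andP[Mx xM].
rewrite /grid_cell; set v := fun z => (z + M) / eps + 1.
rewrite -/(v x) -/(v y) => xy.
have vx1 : 1 <= v x by rewrite lerDr divr_ge0 ?(ltW eps0)//; lra.
have vxs : (Num.truncn (v x) < grid_size M eps)%N.
  rewrite truncn_lt_nat; last by lra.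
  rewrite /grid_size -natr1 ltrD2r; apply: le_lt_trans (truncnS_gt _).
  by rewrite ler_pM2r ?invr_gt0//; lra.
have vyx : Num.truncn (v y) = Num.truncn (v x).
  move: xy; rewrite (minn_idPl (ltnW vxs)) => xy.
  move: vxs; rewrite xy gtn_min ltnn orbF => h.
  by rewrite (minn_idPl (ltnW h)).
have vy1 : 1 <= v y by rewrite -truncn_gt0 vyx truncn_gt0.
have /andP[a1 a2] := truncn_itv (le_trans ler01 vx1).
have /andP[b1 b2] := truncn_itv (le_trans ler01 vy1).
rewrite vyx in b1 b2; rewrite -natr1 in a2 b2.
have xE z : z = (v z - 1) * eps - M by rewrite addrK divfK ?gt_eqF// addrK.
have -> : x - y = (v x - v y) * eps by rewrite {1}(xE x) {1}(xE y); ring.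
rewrite normrM (gtr0_norm eps0) ler_piMl ?(ltW eps0)//.
by rewrite ler_norml; apply/andP; split; lra.
Qed.

End grid.

Section coupling.
Context {d : measure_display} {Omega : measurableType d} {R : realType}.
Variable P : probability Omega R.

Lemma probability_bigcup_ord (k : nat) (B : 'I_k -> set Omega) :
  (forall i, measurable (B i)) -> trivIset setT B ->
  fine (P (\bigcup_i B i)) = \sum_i fine (P (B i)).
Proof.
move=> mB tB.
have -> : \bigcup_i B i = \big[setU/set0]_(i < k) B i.
  rewrite -bigcup_seq; apply: eq_bigcupl; split => // i _ /=.
  exact: mem_index_enum.
rewrite (measure_bigsetU_ord _ xpredT mB tB).
rewrite (eq_bigr (fun i => (fine (P (B i)))%:E)) ?sumEFin// => i _.
by rewrite fineK// fin_num_measure.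
Qed.

Lemma measurable_bigcup_ord (k : nat) (B : 'I_k -> set Omega) :
  (forall i, measurable (B i)) -> measurable (\bigcup_i B i).
Proof. by move=> mB; apply: fin_bigcup_measurable => // i _; exact: mB. Qed.

(** The empirical measure of the first [N] terms of a sequence of reals. *)
Definition empirical_of (N : nat) (x : nat -> R) : {measure set R -> \bar R} :=
  mscale (N%:R^-1)%:nng (msum (fun n => dirac (x n)) N).

Lemma integral_empirical (N : nat) (x : nat -> R) (eta : {RV P >-> R}) (f : R -> R) :
  has_law eta (empirical_of N x) -> measurable_fun setT f -> (forall y, 0 <= f y) ->
  (\int[P]_w (f (eta w))%:E = (N%:R^-1 * \sum_(i < N) f (x i))%:E)%E.
Proof.
move=> law mf f0.
have mf' : measurable_fun setT (fun y => (f y)%:E) by exact/measurable_EFinP.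
transitivity (\int[distribution P eta]_y (f y)%:E)%E.
  by rewrite ge0_integral_distribution//= => y; rewrite lee_fin.
rewrite (eq_measure_integral (empirical_of N x)); last first.
  by move=> A mA _; exact: law.
rewrite ge0_integral_mscale//; last by move=> y _; rewrite lee_fin.
rewrite ge0_integral_measure_sum//; last by move=> y _; rewrite lee_fin.
rewrite EFinM; congr (_ * _)%E; rewrite -sumEFin; apply: eq_bigr => i _.
by rewrite integral_dirac// diracT mul1e.
Qed.

(** A random variable equal to the [n]th sample point on the [n]th of [N]
    disjoint events of probability [1 / N] has the empirical law. *)
Lemma rv_of_partition (N : nat) (x : nat -> R) (E : 'I_N.+1 -> set Omega) :
  (forall n, measurable (E n)) -> trivIset setT E ->
  (forall n, fine (P (E n)) = N.+1%:R^-1) ->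
  exists eta : {RV P >-> R}, [/\ has_law eta (empirical_of N.+1 x),
    forall n w, E n w -> eta w = x n & forall w, exists n, eta w = x n].
Proof.
move=> mE tE PE.
pose Y w := x 0%N + \sum_(n < N.+1) (x n - x 0%N) * \1_(E n) w.
have mY : measurable_fun setT Y.
  apply: measurable_funD => //; apply: measurable_sum => n.
  by apply: measurable_funM => //; exact: measurable_indic.
have YE n w : E n w -> Y w = x n.
  move=> Enw; rewrite /Y (bigD1 n)//= indicE mem_set// mulr1 big1 ?addr0 ?subrKC//.
  move=> m mn; rewrite indicE memNset ?mulr0// => Emw.
  by move/eqP: mn; apply; apply: tE => //; exists w.
have Yx w : exists n, Y w = x n.
  have [[n Enw]|nE] := pselect (exists n, E n w); first by exists n; exact: YE.
  exists 0%N; rewrite /Y big1 ?addr0// => n _; rewrite indicE memNset ?mulr0//.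
  by move=> Enw; apply: nE; exists n.
exists (rv_of P mY); split => // A mA.
have lb (B : set R) : measurable B ->
    N.+1%:R^-1 * \sum_(n < N.+1) (x n \in B)%:R <= fine (P (Y @^-1` B)).
  move=> mB; pose F (n : 'I_N.+1) := if x n \in B then E n else set0.
  have mF n : measurable (F n) by rewrite /F; case: ifP.
  have -> : N.+1%:R^-1 * \sum_(n < N.+1) (x n \in B)%:R = \sum_(n < N.+1) fine (P (F n)).
    rewrite mulr_sumr; apply: eq_bigr => n _; rewrite /F; case: ifP => _.
      by rewrite mulr1 PE.
    by rewrite mulr0 measure0.
  rewrite -probability_bigcup_ord//; last first.
    move=> n m _ _ [w []]; rewrite /F; case: ifP => // _ Enw; case: ifP => // _ Emw.
    by apply: tE => //; exists w.
  rewrite fine_le ?fin_num_measure//.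
  - exact: measurable_bigcup_ord.
  - by rewrite -[X in measurable X]setTI; exact: mY.
  - apply: le_measure; rewrite ?inE.
    + exact: measurable_bigcup_ord.
    + by rewrite -[X in measurable X]setTI; exact: mY.
    + move=> w [n _]; rewrite /F; case: ifPn => // xB Enw.
      by rewrite /preimage /= (YE _ _ Enw); exact/set_mem.
have mYA : measurable (Y @^-1` A) by rewrite -[X in measurable X]setTI; exact: mY.
have -> : empirical_of N.+1 x A = (N.+1%:R^-1 * \sum_(n < N.+1) (x n \in A)%:R)%:E.
  transitivity ((N.+1%:R^-1)%:E * \sum_(n < N.+1) ((x n \in A)%:R : R)%:E)%E; last first.
    by rewrite sumEFin -EFinM.
  rewrite /empirical_of /= /mscale /=; congr (_ * _)%E.
rewrite -[LHS]/(P (Y @^-1` A)) -[LHS]fineK; last by rewrite fin_num_measure.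
congr _%:E; apply/eqP; rewrite eq_le lb// andbT.
have := lb _ (measurableC mA); rewrite preimage_setC probability_setC//.
rewrite fineB ?fin_num_measure// -[X in _ <= X - _]/(1 : R).
have -> : \sum_(n < N.+1) (x n \in ~` A)%:R =
    N.+1%:R - \sum_(n < N.+1) (x n \in A)%:R :> R.
  rewrite [N.+1%:R](_ : _ = \sum_(n < N.+1) 1); last by rewrite sumr_const card_ord.
  rewrite -sumrB; apply: eq_bigr => n _; rewrite in_setC.
  by case: (x n \in A); rewrite ?subrr ?subr0.
move=> h; have : N.+1%:R^-1 * (N.+1%:R - \sum_(n < N.+1) (x n \in A)%:R) <=
  1 - fine (P (Y @^-1` A)) := h.
by rewrite mulrBr mulVf ?pnatr_eq0// lerD2l lerN2.
Qed.

Hypothesis atomlessP : atomless P.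

(** Given a classification [c] of the points of the line into finitely many
    classes, some random variable [eta] with the empirical law of [x] has the
    same class as [xi] outside an event [D] whose probability is at most the
    total excess of the empirical frequencies of the classes over their
    probabilities. *)
Lemma empirical_coupling (xi : {RV P >-> R}) (N K : nat) (x : nat -> R) (c : R -> nat) :
  (forall y, (c y <= K)%N) -> (forall i, measurable [set y | c y = i]) ->
  exists (eta : {RV P >-> R}) (D : set Omega),
    [/\ measurable D, has_law eta (empirical_of N.+1 x),
        forall w, exists n, eta w = x n,
        forall w, ~ D w -> c (eta w) = c (xi w) &
        fine (P D) <= \sum_(i < K.+1) Num.max 0
          (N.+1%:R^-1 * \sum_(n < N.+1) (c (x n) == i)%:R
            - fine (P [set w | c (xi w) = i]))].
Proof.
move=> cK mc.
pose B (i : 'I_K.+1) := [set w | c (xi w) = i].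
pose p (i : 'I_K.+1) := fine (P (B i)).
pose q (i : 'I_K.+1) : R := N.+1%:R^-1 * \sum_(n < N.+1) (c (x n) == i)%:R.
have p0 i : 0 <= p i by exact: fine_ge0.
have q0 i : 0 <= q i by rewrite mulr_ge0// sumr_ge0.
have q1 : \sum_i q i = 1.
  rewrite -mulr_sumr exchange_big/=.
  under eq_bigr => n _.
    rewrite (bigD1 (inord (c (x n))))//= inordK ?ltnS// eqxx big1 ?addr0; last first.
      move=> i; apply: contraNeq; rewrite pnatr_eq0 eqb0 negbK => /eqP ci.
      by apply/eqP/val_inj; rewrite /= inordK ?ltnS.
    over.
  by rewrite sumr_const card_ord mulVf// pnatr_eq0.
have mB i : measurable (B i).
  exact: (measurable_funPTI xi (mc i)).
(* [C i] is the part of the class [i] on which [eta] is to have the class [i] *)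
have hC (i : 'I_K.+1) : exists Ci, [/\ measurable Ci, Ci `<=` B i &
    fine (P Ci) = Num.min (p i) (q i)].
  have [||C CP] := @atomless_subset _ _ _ _ atomlessP (B i) (Num.min (p i) (q i)) (mB i).
  - by rewrite le_min p0 q0.
  - by rewrite ge_min lexx.
  - by exists C.
have [C CP] := choice hC.
have mC i : measurable (C i) by have [] := CP i.
have CB i : C i `<=` B i by have [] := CP i.
have PC i : fine (P (C i)) = Num.min (p i) (q i) by have [] := CP i.
have tC : trivIset setT C.
  move=> i j _ _ [w [/CB Bi /CB Bj]]; apply: val_inj.
  by rewrite /= -[LHS]Bi -[RHS]Bj.
pose U := \bigcup_i C i; have mU : measurable U by exact: measurable_bigcup_ord.
have PU : fine (P (~` U)) = \sum_i (q i - Num.min (p i) (q i)).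
  rewrite probability_setC// fineB ?fin_num_measure//= probability_bigcup_ord//.
  by rewrite sumrB q1; congr (_ - _); apply: eq_bigr => i _.
(* what remains is distributed so that class [i] receives the total mass [q i] *)
have [||D [mD PD tD UD]] := @atomless_partition _ _ _ _ atomlessP K (~` U)
    (fun i => q i - Num.min (p i) (q i)) (measurableC mU).
- by move=> i; rewrite subr_ge0 ge_min lexx orbT.
- by rewrite PU.
have DU i : D i `<=` ~` U by rewrite -UD; exact: bigcup_sup.
pose E i := C i `|` D i.
have mE i : measurable (E i) by exact: measurableU.
have PE i : fine (P (E i)) = q i.
  rewrite measureU//; last first.
    by apply/disj_set2P/disj_setPS => w [Cw /DU]; apply; exists i.
  by rewrite fineD ?fin_num_measure// PC PD subrKC.
have tE : trivIset setT E.
  move=> i j _ _ [w [[Ci|Di] [Cj|Dj]]].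
  - by apply: tC => //; exists w.
  - by exfalso; apply: (DU _ _ Dj); exists i.
  - by exfalso; apply: (DU _ _ Di); exists j.
  - by apply: tD => //; exists w.
(* the mass of a class is shared among the sample points of this class *)
have hF (i : 'I_K.+1) : exists Fi : 'I_N.+1 -> set Omega, [/\ forall n, measurable (Fi n),
    forall n, fine (P (Fi n)) = N.+1%:R^-1 * (c (x n) == i)%:R,
    trivIset setT Fi & \bigcup_n Fi n = E i].
  have [||F FP] := @atomless_partition _ _ _ _ atomlessP N (E i)
    (fun n => N.+1%:R^-1 * (c (x n) == i)%:R) (mE i).
  - by move=> n; rewrite mulr_ge0.
  - by rewrite PE -mulr_sumr.
  - by exists F.
have [F FP] := choice hF.
pose cx n : 'I_K.+1 := inord (c (x n)).
have cxE n : cx n = c (x n) :> nat by rewrite inordK ?ltnS.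
pose G (n : 'I_N.+1) := F (cx n) n.
have mG n : measurable (G n) by have [+ _ _ _] := FP (cx n); exact.
have PG n : fine (P (G n)) = N.+1%:R^-1.
  by have [_ -> _ _] := FP (cx n); rewrite cxE eqxx mulr1.
have GE n : G n `<=` E (cx n).
  by have [_ _ _ <-] := FP (cx n) => w Gw; exists n.
have tG : trivIset setT G.
  move=> n m _ _ [w [Gn Gm]].
  have nm : cx n = cx m by apply: tE => //; exists w; split; exact: GE.
  have [_ _ tF _] := FP (cx n); apply: tF => //; exists w; split => //.
  by rewrite nm.
have [eta [law etaG etax]] := rv_of_partition x mG tG PG.
have mGU : measurable (\bigcup_n G n) by exact: measurable_bigcup_ord.
(* the union of the [G n] is almost the whole space, but perhaps not all of it *)
exists eta, (~` U `|` ~` \bigcup_n G n); split => //.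
- by apply: measurableU; exact: measurableC.
- move=> w /not_orP[/contrapT Uw /contrapT[n _ Gw]].
  rewrite (etaG _ _ Gw); have [Cw|/DU//] := GE _ _ Gw.
  by rewrite -cxE; have := CB _ _ Cw.
apply: (@le_trans _ _ (fine (P (~` U)) + fine (P (~` \bigcup_n G n)))).
  rewrite -fineD ?fin_num_measure//; try exact: measurableC.
  rewrite fine_le ?fin_numD ?fin_num_measure//; try exact: measurableC.
  + by apply: measurableU; exact: measurableC.
  + by apply: measureU2; exact: measurableC.
rewrite [X in _ + X](_ : _ = 0) ?addr0; last first.
  rewrite probability_setC// fineB ?fin_num_measure//= probability_bigcup_ord//.
  under eq_bigr do rewrite PG.
  by rewrite sumr_const card_ord -[_ *+ _]mulr_natl divff ?subrr// pnatr_eq0.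
rewrite PU; apply: ler_sum => i _; rewrite -/(p i) -/(q i).
rewrite le_max; case: (leP (p i) (q i)) => _; apply/orP; first by right.
by left; rewrite subrr.
Qed.

End coupling.

(** * Continuity of the support functional and convergence *)

Section support_functional.
Context {d : measure_display} {Omega : measurableType d} {R : realType}.
Variable P : probability Omega R.
Variable S : set {RV P >-> R}.

Lemma integrable_pairing (eta h : {RV P >-> R}) :
  (\int[P]_w (`|eta w| * `|h w|)%:E < +oo)%E ->
  P.-integrable setT (EFin \o (eta \* h)%R).
Proof.
move=> fin; apply/integrableP; split.
  by apply/measurable_EFinP; exact: measurable_funM.
by under eq_integral do rewrite /= normrM.
Qed.

Lemma rho_le (eta xi : {RV P >-> R}) (delta : R) :
  (forall h, S h -> (\int[P]_w (`|eta w| * `|h w|)%:E < +oo)%E) ->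
  (forall h, S h -> (\int[P]_w (`|xi w| * `|h w|)%:E < +oo)%E) ->
  (forall h, S h -> (\int[P]_w (`|xi w - eta w| * `|h w|)%:E <= delta%:E)%E) ->
  (rho S eta <= rho S xi + delta%:E)%E.
Proof.
move=> etaS xiS diffS; apply: ge_ereal_sup => _ [h Sh <-].
have ie := integrable_pairing (etaS h Sh).
have ix := integrable_pairing (xiS h Sh).
apply: (@le_trans _ _ ('E_P[(xi \* h)%R] + delta%:E)%E); last first.
  by apply: leeD => //; apply: ereal_sup_ubound; exists h.
rewrite unlock -leeBlDl; last exact: integrable_fin_num ix.
rewrite -integralB//.
apply: le_trans (diffS h Sh).
apply: (le_trans (lee_abs _)); apply: (le_trans (le_abse_integral _ _ _)) => //.
  by have /integrableP[] := integrableB measurableT ie ix.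
rewrite le_eqVlt; apply/orP; left; apply/eqP; apply: eq_integral => w _ /=.
by rewrite -mulrBl normrM distrC.
Qed.

Lemma rho_fin_num (xi : {RV P >-> R}) (C : R) : S !=set0 ->
  (forall h, S h -> (\int[P]_w (`|xi w| * `|h w|)%:E <= C%:E)%E) ->
  rho S xi \is a fin_num.
Proof.
move=> [h0 Sh0] xiC.
have le h : S h -> (`| 'E_P[(xi \* h)%R] | <= C%:E)%E.
  move=> Sh; rewrite unlock; apply: le_trans (xiC h Sh).
  apply: (le_trans (le_abse_integral _ _ _)) => //.
    by apply/measurable_EFinP; exact: measurable_funM.
  rewrite le_eqVlt; apply/orP; left; apply/eqP; apply: eq_integral => w _ /=.
  by rewrite normrM.
rewrite fin_numE; apply/andP; split.
  rewrite gt_eqF//; apply: (@lt_le_trans _ _ ('E_P[(xi \* h0)%R])%E).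
    have : ('E_P[(xi \* h0)%R])%E \is a fin_num.
      by rewrite fin_num_abs (le_lt_trans (le _ Sh0))// ltry.
    by rewrite fin_numElt => /andP[].
  by apply: ereal_sup_ubound; exists h0.
rewrite lt_eqF//; apply: (@le_lt_trans _ _ C%:E); last exact: ltry.
apply: ge_ereal_sup => _ [h Sh <-].
by apply: le_trans (le _ Sh); exact: lee_abs.
Qed.

End support_functional.

Section tails.
Context {R : realType}.
(** [tail m y] is the modulus of [y] if it exceeds [m], and else [0]. *)
Definition tail (m y : R) : R := if m < `|y| then `|y| else 0.

Lemma tail_ge0 m y : 0 <= tail m y.
Proof. by rewrite /tail; case: ifP. Qed.

Lemma norm_le_tail m y : 0 <= m -> `|y| <= m + tail m y.
Proof.
move=> m0; rewrite /tail; case: ltP => [_|ym]; last by rewrite addr0.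
by rewrite lerDr.
Qed.

Lemma measurable_tail m : measurable_fun setT (tail m).
Proof.
by apply: measurable_fun_ifT => //; apply: measurable_fun_ltr => //; exact: normr_measurable.
Qed.

End tails.

Section consistency.
Context {R : realType} {d : measure_display} {Omega : measurableType d}.
Variables (P : probability Omega R) (phi : R -> R) (S : set {RV P >-> R}).
Hypothesis atomlessP : atomless P.
Hypothesis hphi : young_integrand phi.
Hypothesis S0 : S !=set0.
Hypothesis S_density : S `<=` probability_density P.
Local Notation Psi := (conjugate_young phi).
Local Notation LPsi := (orlicz_space P Psi).

Let Psi0 : Psi 0 = 0. Proof. exact: young0. Qed.
Let Psi_ge0 := conjugate_young_ge0 hphi.
Let mPsi : measurable_fun setT Psi := measurable_conjugate_young hphi measurableT.



Variable K : R.
Hypothesis K_gt0 : 0 < K.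
Hypothesis K_bound : forall Y : {RV P >-> R}, (forall w, 0 <= Y w) ->
  (\int[P]_w (Psi (Y w))%:E <= 1)%E ->
  forall h, S h -> (\int[P]_w (Y w * `|h w|)%:E <= K%:E)%E.

(** The uniform bound on the unit ball, in homogeneous form. *)
Lemma pairing_bound (Y : Omega -> R) (k : R) (h : {RV P >-> R}) :
  measurable_fun setT Y -> (forall w, 0 <= Y w) -> 0 < k ->
  (\int[P]_w (Psi (k * Y w))%:E <= 1)%E -> S h ->
  (\int[P]_w (Y w * `|h w|)%:E <= (K / k)%:E)%E.
Proof.
move=> mY Y0 k0 kY Sh.
have mkY : measurable_fun setT (fun w => k * Y w) by exact: measurable_funM.
have := K_bound (Y := rv_of P mkY) (fun w => mulr_ge0 (ltW k0) (Y0 w)) kY Sh.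
rewrite /=; under eq_integral do rewrite -mulrA EFinM.
rewrite ge0_integralZl_EFin//=; first last.
- exact: ltW.
- by apply/measurable_EFinP; apply: measurable_funM => //; exact: measurableT_comp.
- by move=> w _; rewrite lee_fin mulr_ge0.
by move=> kI; rewrite EFinM muleC lee_pdivlMl.
Qed.

Let mtail m (zeta : {RV P >-> R}) : measurable_fun setT (fun w => tail m (zeta w)).
Proof. by apply: (measurableT_comp (measurable_tail m)). Qed.

Lemma norm_pairing_lty (zeta h : {RV P >-> R}) (m k : R) : 0 <= m -> 0 < k ->
  (\int[P]_w (Psi (k * tail m (zeta w)))%:E <= 1)%E -> S h ->
  (\int[P]_w (`|zeta w| * `|h w|)%:E <= (m + K / k)%:E)%E.
Proof.
move=> m0 k0 kz Sh.
have mh : measurable_fun setT (fun w => `|h w|) by exact: measurableT_comp.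
apply: (@le_trans _ _ (\int[P]_w (m%:E * `|h w|%:E + (tail m (zeta w) * `|h w|)%:E))%E).
  apply: ge0_le_integral => //=.
  - by apply/measurable_EFinP; apply: measurable_funM => //; exact: measurableT_comp.
  - apply: emeasurable_funD.
      by apply: measurable_funeM; exact/measurable_EFinP.
    by apply/measurable_EFinP; exact: measurable_funM.
  - move=> w _; rewrite -EFinM -EFinD lee_fin -mulrDl ler_wpM2r//.
    exact: norm_le_tail.
rewrite ge0_integralD//=; first last.
- by apply/measurable_EFinP; exact: measurable_funM.
- by move=> w _; rewrite lee_fin mulr_ge0// tail_ge0.
- by apply: measurable_funeM; exact/measurable_EFinP.
- by move=> w _; rewrite -EFinM lee_fin mulr_ge0.
rewrite ge0_integralZl_EFin//=; last exact/measurable_EFinP.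
rewrite (density_norm1 S_density Sh) mule1 EFinD leeD//.
by apply: pairing_bound => // w; exact: tail_ge0.
Qed.

(** If [xi] and [eta] are close off [D] wherever one of them is at most [m], then
    their difference is at most [eps] plus [2 * m] on [D] plus the two tails, and
    the uniform bound applies to each term. *)
Lemma coupling_pairing (xi eta h : {RV P >-> R}) (D : set Omega) (m eps c k : R) :
  measurable D -> 0 <= m -> 0 <= eps -> 0 < c -> 0 < k ->
  (forall w, ~ D w -> `|xi w| <= m \/ `|eta w| <= m -> `|xi w - eta w| <= eps) ->
  Psi c * fine (P D) <= 1 ->
  (\int[P]_w (Psi (k * tail m (xi w)))%:E <= 1)%E ->
  (\int[P]_w (Psi (k * tail m (eta w)))%:E <= 1)%E -> S h ->
  (\int[P]_w (`|xi w - eta w| * `|h w|)%:E <=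
     (eps + 2 * m * (K / c) + K / k + K / k)%:E)%E.
Proof.
move=> mD m0 eps0 c0 k0 close PD txi teta Sh.
have mh : measurable_fun setT (fun w => `|h w|) by exact: measurableT_comp.
have mI : measurable_fun setT (\1_D : Omega -> R) by exact: measurable_indic.
have I0 w : 0 <= \1_D w :> R by rewrite indicE.
have bD : (\int[P]_w (\1_D w * `|h w|)%:E <= (K / c)%:E)%E.
  apply: (pairing_bound mI I0 c0 _ Sh).
  have PsiI w : (Psi (c * \1_D w))%:E = ((Psi c)%:E * (\1_D w)%:E)%E.
    rewrite -EFinM indicE; case: (w \in D); rewrite ?mulr1// !mulr0.
    by congr _%:E; exact: Psi0.
  under eq_integral do rewrite PsiI.
  rewrite ge0_integralZl_EFin//=; last exact/measurable_EFinP.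
  rewrite (_ : \int[P]_x (\1_D x)%:E = (fine (P D))%:E)%E -?EFinM ?lee_fin//.
  by rewrite fineK ?fin_num_measure// integral_indic// setIT.
pose U w := eps * `|h w|.
pose V w := 2 * m * (\1_D w * `|h w|).
pose T1 w := tail m (xi w) * `|h w|.
pose T2 w := tail m (eta w) * `|h w|.
have mU : measurable_fun setT U by exact: measurable_funM.
have mV : measurable_fun setT V by apply: measurable_funM => //; exact: measurable_funM.
have mT1 : measurable_fun setT T1 by exact: measurable_funM.
have mT2 : measurable_fun setT T2 by exact: measurable_funM.
have U0 w : 0 <= U w by rewrite mulr_ge0.
have V0 w : 0 <= V w by rewrite !mulr_ge0.
have T10 w : 0 <= T1 w by rewrite mulr_ge0// tail_ge0.
have T20 w : 0 <= T2 w by rewrite mulr_ge0// tail_ge0.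
apply: (@le_trans _ _ (\int[P]_w ((U w)%:E + (V w)%:E + (T1 w)%:E + (T2 w)%:E))%E).
  apply: ge0_le_integral => //=.
  - apply/measurable_EFinP; apply: measurable_funM => //.
    by apply: measurableT_comp => //; exact: measurable_funB.
  - by apply: emeasurable_funD; [apply: emeasurable_funD; [apply: emeasurable_funD|]|];
      exact/measurable_EFinP.
  - move=> w _; rewrite -!EFinD lee_fin /U /V /T1 /T2 (mulrA (2 * m)) -!mulrDl ler_wpM2r//.
    have tx := tail_ge0 m (xi w); have te := tail_ge0 m (eta w).
    have nx := norm_le_tail (xi w) m0; have ne := norm_le_tail (eta w) m0.
    have tri : `|xi w - eta w| <= `|xi w| + `|eta w| by rewrite ler_normB.
    have [Dw|nDw] := pselect (D w).
      by rewrite indicE mem_set// mulr1; lra.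
    rewrite indicE memNset// mulr0 addr0.
    have [xm|xm] := leP `|xi w| m.
      by have := close _ nDw (or_introl xm); lra.
    have [em|em] := leP `|eta w| m.
      by have := close _ nDw (or_intror em); lra.
    by move: tri; rewrite /tail xm em; lra.
have mUe : measurable_fun setT (fun w => (U w)%:E) by exact/measurable_EFinP.
have mVe : measurable_fun setT (fun w => (V w)%:E) by exact/measurable_EFinP.
have mT1e : measurable_fun setT (fun w => (T1 w)%:E) by exact/measurable_EFinP.
have mT2e : measurable_fun setT (fun w => (T2 w)%:E) by exact/measurable_EFinP.
have mUV : measurable_fun setT (fun w => (U w)%:E + (V w)%:E)%E by exact: emeasurable_funD.
have mUVT : measurable_fun setT (fun w => (U w)%:E + (V w)%:E + (T1 w)%:E)%E.
  exact: emeasurable_funD.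
rewrite ge0_integralD//; first last.
- by move=> w _; rewrite lee_fin.
- by move=> w _; rewrite !adde_ge0 ?lee_fin.
rewrite ge0_integralD//; first last.
- by move=> w _; rewrite lee_fin.
- by move=> w _; rewrite !adde_ge0 ?lee_fin.
rewrite ge0_integralD//; first last.
- by move=> w _; rewrite lee_fin.
- by move=> w _; rewrite lee_fin.
rewrite !EFinD; apply: leeD; [apply: leeD; [apply: leeD|]|].
- rewrite /U; under eq_integral do rewrite EFinM.
  rewrite ge0_integralZl_EFin//=; last exact/measurable_EFinP.
  by rewrite (density_norm1 S_density Sh) mule1.
- rewrite /V; under eq_integral do rewrite EFinM.
  rewrite ge0_integralZl_EFin//=; first last.
  + by rewrite mulr_ge0.
  + by apply/measurable_EFinP; exact: measurable_funM.
  by rewrite [leRHS]EFinM lee_wpmul2l// lee_fin mulr_ge0.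
- by apply: pairing_bound => // w; exact: tail_ge0.
- by apply: pairing_bound => // w; exact: tail_ge0.
Qed.

Let mPsitail k m : measurable_fun setT (fun y => Psi (k * tail m y)).
Proof.
apply: (measurableT_comp mPsi); apply: measurable_funM => //.
exact: measurable_tail.
Qed.

Lemma Psi_tail_le k m y : Psi (k * tail m y) <= Psi (k * y).
Proof.
apply: (le_conjugate_young hphi); rewrite !normrM ler_wpM2l//.
by rewrite /tail; case: ifP => _; rewrite ?normr_id ?normr0.
Qed.

Lemma heart_tail_lty (xi : {RV P >-> R}) (k m : R) : orlicz_heart P Psi xi -> 0 < k ->
  (\int[P]_w (Psi (k * tail m (xi w)))%:E < +oo)%E.
Proof.
move=> /[apply]; rewrite unlock; apply: le_lt_trans.
apply: ge0_le_integral => //.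
- by move=> w _; rewrite lee_fin; exact: Psi_ge0.
- by apply/measurable_EFinP; exact: (measurableT_comp (mPsitail k m)).
- apply/measurable_EFinP; apply: (measurableT_comp mPsi).
  by apply: measurable_funM.
- by move=> w _; rewrite lee_fin Psi_tail_le.
Qed.

(** Dominated convergence, with the finite integral of [Psi (k * xi)] as bound:
    this is where [xi] has to lie in the Orlicz heart. *)
Lemma heart_tail_small (xi : {RV P >-> R}) (k : R) : orlicz_heart P Psi xi -> 0 < k ->
  exists m : nat, (\int[P]_w (Psi (k * tail m%:R (xi w)))%:E <= (2^-1)%:E)%E.
Proof.
move=> xiM k0.
have mPk : measurable_fun setT (fun w => (Psi (k * xi w))%:E).
  by apply/measurable_EFinP; apply: (measurableT_comp mPsi); exact: measurable_funM.
have : (\int[P]_w (Psi (k * tail n%:R (xi w)))%:E)%E @[n --> \oo] --> (\int[P]_w cst 0 w)%E.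
  apply: (@dominated_cvg _ _ _ P setT measurableT
    (fun n w => (Psi (k * tail n%:R (xi w)))%:E) (cst 0%E) (fun w => (Psi (k * xi w))%:E)).
  - by move=> n; apply/measurable_EFinP; exact: (measurableT_comp (mPsitail k n%:R)).
  - move=> w _; apply: cvg_near_cst; exists (Num.truncn `|xi w|).+1 => // n /= hn.
    rewrite /tail ltNge; have -> : `|xi w| <= n%:R.
      by apply: (le_trans (ltW (truncnS_gt _))); rewrite ler_nat.
    by rewrite /= mulr0; congr _%:E; exact: Psi0.
  - by [].
  - apply/integrableP; split => //.
    under eq_integral do rewrite gee0_abs ?lee_fin ?Psi_ge0//.
    by have := xiM _ k0; rewrite unlock.
  - move=> n w _; rewrite gee0_abs ?lee_fin; last exact: Psi_ge0.
    exact: Psi_tail_le.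
rewrite integral0 => /fine_cvgP[[N1 _ fin] /cvgrPdist_le small].
have half0 : 0 < 2^-1 :> R by rewrite invr_gt0.
have [N2 _ {}small] := small _ half0.
exists (maxn N1 N2); set n := maxn N1 N2.
have nfin := fin n (leq_maxl _ _); have := small n (leq_maxr _ _).
rewrite /= sub0r normrN => /(le_trans (ler_norm _)) nle.
by rewrite -(fineK nfin) lee_fin.
Qed.

(** Sample sequences whose empirical means of two countable families of
    functions are asymptotically at most the means: the tails, transformed by
    the Young function, and the indicators of the cells of the grids. *)
Definition good_sample (xi : {RV P >-> R}) (x : nat -> R) : Prop :=
  (forall k m : nat, forall delta, 0 < delta -> \forall N \near \oo,
    \sum_(i < N) Psi (k.+1%:R * tail m%:R (x i)) <=
    N%:R * (fine (\int[P]_w (Psi (k.+1%:R * tail m%:R (xi w)))%:E) + delta)) /\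
  (forall m j l : nat, forall delta, 0 < delta -> \forall N \near \oo,
    \sum_(i < N) (grid_cell m%:R j.+1%:R^-1 (x i) == l)%:R <=
    N%:R * (fine (\int[P]_w (grid_cell m%:R j.+1%:R^-1 (xi w) == l)%:R%:E) + delta)).

Lemma ae_good_sample (X : nat -> {RV P >-> R}) (xi : {RV P >-> R}) :
  orlicz_heart P Psi xi -> independent_seq X ->
  (forall n, has_law (X n) (distribution P xi)) ->
  {ae P, forall w, good_sample xi (X ^~ w)}.
Proof.
move=> xiM indepX lawX.
have A : {ae P, forall w, forall k m : nat, forall delta, 0 < delta ->
    \forall N \near \oo, \sum_(i < N) Psi (k.+1%:R * tail m%:R (X i w)) <=
    N%:R * (fine (\int[P]_w (Psi (k.+1%:R * tail m%:R (xi w)))%:E) + delta)}.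
  apply: ae_foralln => k; apply: ae_foralln => m.
  apply: (slln_upper indepX lawX (f := fun y => Psi (k.+1%:R * tail m%:R y))).
  - exact: mPsitail.
  - by move=> y; exact: Psi_ge0.
  - exact: heart_tail_lty.
have B : {ae P, forall w, forall m j l : nat, forall delta, 0 < delta ->
    \forall N \near \oo, \sum_(i < N) (grid_cell m%:R j.+1%:R^-1 (X i w) == l)%:R <=
    N%:R * (fine (\int[P]_w (grid_cell m%:R j.+1%:R^-1 (xi w) == l)%:R%:E) + delta)}.
  apply: ae_foralln => m; apply: ae_foralln => j; apply: ae_foralln => l.
  have mg : measurable_fun setT (fun y : R => (grid_cell m%:R j.+1%:R^-1 y == l)%:R : R).
    have mc := @measurable_grid_cell R m%:R j.+1%:R^-1 l ltac:(by rewrite invr_gt0).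
    rewrite [X in measurable_fun _ X](_ : _ =
        \1_[set y | grid_cell m%:R j.+1%:R^-1 y = l] :> (R -> R)).
      exact: measurable_indic.
    apply/funext => y; rewrite indicE; congr (_ : bool)%:R.
    by apply/eqP/idP => [h|/set_mem//]; apply/mem_set.
  apply: (slln_upper indepX lawX (f := fun y => (grid_cell m%:R j.+1%:R^-1 y == l)%:R)) => //.
  apply: (@le_lt_trans _ _ (\int[P]_w (cst 1 w))%E); last first.
    by rewrite integral_cst//= probability_setT mule1 ltry.
  apply: ge0_le_integral => //.
  - apply/measurable_EFinP; exact: (measurableT_comp mg).
  - by move=> w _; rewrite lee_fin lern1 leq_b1.
by apply: filterS2 A B => w a b; split.
Qed.

(** For large samples, a random variable with the empirical law has nearly the
    same value of [rho S] as [xi]. *)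
Lemma empirical_approximation (xi : {RV P >-> R}) (x : nat -> R) (delta : R) :
  orlicz_heart P Psi xi -> good_sample xi x -> 0 < delta ->
  \forall N \near \oo, exists eta : {RV P >-> R},
    [/\ LPsi eta, has_law eta (empirical_of N x),
      (rho S eta <= rho S xi + delta%:E)%E & (rho S xi <= rho S eta + delta%:E)%E].
Proof.
move=> xiM [goodT goodC] delta0.
(* [k], [j] and [c] make the tails contribute at most [delta / 8] each, and
   [eps] and the event [D] at most [delta / 4] each *)
pose k := Num.truncn (8 * K / delta).
have k0 : 0 < k.+1%:R :> R by rewrite ltr0n.
have Kk : K / k.+1%:R <= delta / 8.
  rewrite ler_pdivrMr// -ler_pdivrMl ?divr_gt0// invf_div mulrAC.
  exact/ltW/truncnS_gt.
have [m xim] := heart_tail_small xiM k0.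
pose j := Num.truncn (4 / delta); pose eps : R := j.+1%:R^-1.
have eps0 : 0 < eps by rewrite invr_gt0.
have epsd : eps <= delta / 4.
  rewrite -[leRHS]invrK lef_pV2 ?posrE ?invr_gt0 ?divr_gt0// invf_div.
  exact/ltW/truncnS_gt.
pose c := 8 * m%:R * K / delta + 1.
have c0 : 0 < c by rewrite ltr_pwDr// !mulr_ge0 ?invr_ge0// ltW.
have cd : 2 * m%:R * (K / c) <= delta / 4.
  rewrite mulrA ler_pdivrMr//.
  have : delta / 4 * (8 * m%:R * K / delta) = 2 * m%:R * K.
    by field; rewrite gt_eqF.
  rewrite /c mulrDr mulr1 => ->; rewrite lerDl; lra.
pose L := grid_size m%:R eps.
pose d' := (L.+1%:R * (Psi c + 1))^-1.
have Pc0 : 0 <= Psi c by exact: Psi_ge0.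
have Pc1 : 0 < Psi c + 1 by rewrite ltr_pwDr.
have d'0 : 0 < d' by rewrite invr_gt0 mulr_gt0 ?ltr0n.
have half0 : 0 < 2^-1 :> R by rewrite invr_gt0.
have nearC : \forall N \near \oo, forall l : 'I_L.+1,
    \sum_(i < N) (grid_cell m%:R j.+1%:R^-1 (x i) == l)%:R <=
    N%:R * (fine (\int[P]_w (grid_cell m%:R j.+1%:R^-1 (xi w) == l)%:R%:E) + d').
  by apply: filter_forall => l; exact: goodC.
have nearT := goodT k m _ half0.
have near0 : \forall N \near \oo, (0 < N)%N by exists 1%N.
apply: filterS3 nearC nearT near0 => -[//|N] hC hT _.
have N0 : 0 < N.+1%:R :> R by rewrite ltr0n.
have [|eta [D [mD law etax etac PD]]] := @empirical_coupling _ _ _ _ atomlessP xi N L x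
    (grid_cell m%:R eps) (grid_cell_le _ _).
  by move=> i; exact: measurable_grid_cell.
have PDc : Psi c * fine (P D) <= 1.
  have {}PD : fine (P D) <= (Psi c + 1)^-1.
    apply: (le_trans PD); apply: (@le_trans _ _ (\sum_(i < L.+1) d')); last first.
      by rewrite sumr_const card_ord -[_ *+ _]mulr_natl /d' invfM mulrA divff ?mul1r ?pnatr_eq0.
    apply: ler_sum => i _; rewrite ge_max (ltW d'0)/= lerBlDr addrC.
    rewrite mulrC ler_pdivrMr// mulrC; apply: (le_trans (hC i)).
    rewrite le_eqVlt; apply/orP; left; apply/eqP; congr (_ * (fine _ + _)).
    have mB : measurable [set w | grid_cell m%:R eps (xi w) = i].
      exact: (measurable_funPTI xi (@measurable_grid_cell R m%:R eps i eps0)).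
    transitivity (\int[P]_w (\1_[set w | grid_cell m%:R eps (xi w) = i] w)%:E)%E.
      apply: eq_integral => w _; rewrite indicE; congr (_ : bool)%:R%:E.
      by apply/eqP/idP => [h|/set_mem//]; apply/mem_set.
    by rewrite integral_indic// setIT.
  apply: (@le_trans _ _ (Psi c * (Psi c + 1)^-1)); first by rewrite ler_wpM2l.
  by rewrite ler_pdivrMr// mul1r lerDl.
have txi : (\int[P]_w (Psi (k.+1%:R * tail m%:R (xi w)))%:E <= 1)%E.
  by apply: (le_trans xim); rewrite lee_fin invf_le1// ler1n.
have teta : (\int[P]_w (Psi (k.+1%:R * tail m%:R (eta w)))%:E <= 1)%E.
  rewrite (integral_empirical law (mPsitail k.+1%:R m%:R)); last by move=> y; exact: Psi_ge0.
  rewrite lee_fin mulrC ler_pdivrMr// mul1r; apply: (le_trans hT).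
  rewrite ler_piMr//; have xif : (\int[P]_w (Psi (k.+1%:R * tail m%:R (xi w)))%:E)%E \is a fin_num.
    rewrite ge0_fin_numE; last by apply: integral_ge0 => w _; rewrite lee_fin; exact: Psi_ge0.
    exact: heart_tail_lty.
  have : fine (\int[P]_w (Psi (k.+1%:R * tail m%:R (xi w)))%:E)%E <= 2^-1.
    by rewrite -lee_fin fineK.
  by lra.
have close w : ~ D w -> `|xi w| <= m%:R \/ `|eta w| <= m%:R -> `|xi w - eta w| <= eps.
  move=> /etac ce [xm|em]; first exact: (grid_cell_close _ eps0 xm).
  by rewrite distrC; apply: (grid_cell_close _ eps0 em).
have m0 : 0 <= m%:R :> R by [].
have diff h : S h -> (\int[P]_w (`|xi w - eta w| * `|h w|)%:E <= delta%:E)%E.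
  move=> Sh; apply: (le_trans (coupling_pairing mD m0 (ltW eps0) c0 k0 close PDc txi teta Sh)).
  rewrite lee_fin; apply: (@le_trans _ _ (delta / 4 + delta / 4 + delta / 8 + delta / 8)).
    by rewrite !lerD.
  by lra.
have xiS h : S h -> (\int[P]_w (`|xi w| * `|h w|)%:E < +oo)%E.
  by move=> Sh; apply: (le_lt_trans (norm_pairing_lty m0 k0 txi Sh)); rewrite ltry.
have etaS h : S h -> (\int[P]_w (`|eta w| * `|h w|)%:E < +oo)%E.
  by move=> Sh; apply: (le_lt_trans (norm_pairing_lty m0 k0 teta Sh)); rewrite ltry.
exists eta; split => //.
- exists 1 => //; rewrite unlock.
  have mP1 : measurable_fun setT (fun y : R => Psi (1 * y)).
    by apply: (measurableT_comp mPsi); exact: measurable_funM.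
  by rewrite (integral_empirical law mP1) ?ltry// => y; exact: Psi_ge0.
- exact: rho_le.
- apply: rho_le => // h Sh; under eq_integral do rewrite distrC.
  exact: diff.
Qed.

Lemma rho_heart_fin_num (xi : {RV P >-> R}) : orlicz_heart P Psi xi ->
  rho S xi \is a fin_num.
Proof.
move=> xiM; have [m xim] := heart_tail_small xiM ltr01.
apply: (@rho_fin_num _ _ _ _ _ _ (m%:R + K / 1)) => // h Sh.
apply: norm_pairing_lty => //; apply: (le_trans xim).
by rewrite lee_fin invf_le1// ler1n.
Qed.

End consistency.

Theorem theorem1 (R : realType) (d : measure_display)
    (Omega : measurableType d) (P : probability Omega R)
    (phi : R -> R) (S : set {RV P >-> R})
    (xi : {RV P >-> R}) (xi_ : nat -> {RV P >-> R}) :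
  atomless P ->
  young_integrand phi ->
  let LPhi := orlicz_space P (young phi) in
  let LPsi := orlicz_space P (conjugate_young phi) in
  let MPsi := orlicz_heart P (conjugate_young phi) in
  S !=set0 ->
  S `<=` LPhi ->
  S `<=` probability_density P ->
  convex_set (S : set (convex_lmodType {mfun Omega >-> R})) ->
  L1_closed S ->
  rearrangement_invariant LPsi (rho S) ->
  MPsi xi ->
  independent_seq xi_ ->
  (forall n, has_law (xi_ n) (distribution P xi)) ->
  {ae P, forall w,
    on_law LPsi (rho S) (empirical xi_ N w) @[N --> \oo] -->
      on_law LPsi (rho S) (distribution P xi)}.
Proof.
move=> atomlessP hphi LPhi LPsi MPsi S0 SPhi Sd Sconv Scl ri xiM indep law.
have [K K0 KB] := densities_bounded Sd Scl Sconv hphi SPhi.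
have xiL : LPsi xi by exists 1 => //; exact: xiM.
rewrite (on_lawE ri xiL)//.
have finxi := rho_heart_fin_num hphi S0 Sd KB xiM.
apply: filterS (ae_good_sample hphi xiM indep law) => w gw.
rewrite -(fineK finxi).
have close delta : 0 < delta -> \forall N \near \oo,
    on_law LPsi (rho S) (empirical xi_ N w) \is a fin_num /\
    `|fine (rho S xi) - fine (on_law LPsi (rho S) (empirical xi_ N w))| <= delta.
  move=> delta0.
  have := empirical_approximation atomlessP hphi Sd K0 KB xiM gw delta0.
  apply: filterS => N [eta [etaL etalaw le1 le2]].
  rewrite (on_lawE ri etaL etalaw).
  move: finxi le1 le2; case: (rho S xi) => // r _.
  case: (rho S eta) => [s| |]//=.
  rewrite -!EFinD !lee_fin => le1 le2; split => //.
  by rewrite ler_norml; apply/andP; split; lra.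
apply/fine_cvgP; split.
  by apply: filterS (close 1 ltr01) => N [].
by apply/cvgrPdist_le => delta /close; apply: filterS => N [].
Qed.
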